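(* Let $\lambda\in\mathbb{C}$ be nonzero and let $\kappa>0$. Let $H^{\mathrm{per}}_{[1,L]}$ be the truncated $1/3$-filled Haldane pseudopotential Hamiltonian with periodic boundary conditions on the ring $[1,L]$ (see context), and let $f:[0,\infty)\to[0,\infty)$ be the function $f(r)=\sup_{n\ge 4}f_n(r)$ defined in the context. Then $f$ is monotone increasing, and if $f(|\lambda|^2)<1/3$, then $$\liminf_{L\to\infty}\mathrm{gap}\big(H^{\mathrm{per}}_{[1,L]}\big)\ \ge\ \min\left\{\frac{\kappa}{6(1+2|\lambda|^2)}\Big(1-\sqrt{3f(|\lambda|^2)}\Big)^2,\ \gamma^{\mathrm{per}}\right\},$$ where $$\gamma^{\mathrm{per}}=\frac13\min\left\{1,\ \frac{\kappa}{2+2\kappa|\lambda|^2},\ \frac{\kappa}{\kappa+2}\right\}.$$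
   Context: For a finite interval $\Lambda=[1,L]\subset\mathbb{Z}$ let $\mathcal{H}_\Lambda=\bigotimes_{x\in\Lambda}\mathbb{C}^2$, with orthonormal basis $|0\rangle,|1\rangle$ of each $\mathbb{C}^2$. Set $\sigma^-=|0\rangle\langle 1|$, $\sigma^+=(\sigma^-)^*$, $n=\sigma^+\sigma^-$; a subscript $x$ means the operator acts on site $x$. With addition of sites modulo $L$ (ring geometry) define $$q_x=\sigma_x^-\sigma_{x+1}^--\lambda\,\sigma_{x-1}^-\sigma_{x+2}^-,\qquad H^{\mathrm{per}}_\Lambda=\sum_{x=1}^{L}\big(n_xn_{x+2}+\kappa\,q_x^*q_x\big).$$ The ground state energy of $H^{\mathrm{per}}_\Lambda$ is $0$, and $\mathrm{gap}(H^{\mathrm{per}}_\Lambda)$ is the difference between its first excited and ground state energies, i.e. its smallest positive eigenvalue. Definition of $f$. For $r\ge0$ let $\beta_\pm=\frac12\big(1\pm\sqrt{1+4r}\big)$, $\beta=\beta_-/\beta_+$, and for integers $n\ge1$ let $\beta_n=\frac{1}{\beta_+}\frac{1-\beta^{n}}{1-\beta^{n+1}}$ (all depending on $r$). For $n\ge4$ put $$f_n(r)=r\,\beta_n\beta_{n-2}\left(\frac{[1-\beta_{n-1}(1+r)]^2}{1+2r}+\beta_{n-3}\frac{r(1-\beta_{n-1})^2}{1+r}\right),\qquad f(r)=\sup_{n\ge4}f_n(r).$$ *)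

(* Defs.v *)
From HB Require Import structures.
From mathcomp Require Import all_boot all_order all_algebra.
From mathcomp Require Import complex lra.
From mathcomp Require Import all_classical all_reals all_analysis.
Import Order.TTheory GRing.Theory Num.Theory.

Set Implicit Arguments.
Unset Strict Implicit.
Unset Printing Implicit Defensive.

Local Open Scope ring_scope.
Local Open Scope complex_scope.
Local Open Scope classical_set_scope.

Section TensorProduct.
Variables (R : realType) (L : nat).

(* The occupation-number basis of the tensor product of L copies of C^2. *)
Definition config := {ffun 'I_L -> 'I_2}.

(* Operators are the matrices < s | A | t > in the basis of configurations,
   acting on column vectors. *)
Definition operator := 'M[R[i]]_#|{: config}|.

Definition config_of (s : 'I_#|{: config}|) : config := enum_val s.

Definition adjoint n (A : 'M[R[i]]_n) : 'M[R[i]]_n := map_mx Num.conj A^T.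

Definition tensor_op (A : 'I_L -> 'M[R[i]]_2) : operator :=
  \matrix_(s, t) \prod_(y < L) A y (config_of s y) (config_of t y).

Definition site_op (A : 'M[R[i]]_2) (x : 'I_L) : operator :=
  tensor_op (fun y => if y == x then A else 1%:M).

End TensorProduct.

Section Hamiltonian.
Variable R : realType.

Definition sigma_minus : 'M[R[i]]_2 := delta_mx 0 1.
Definition sigma_plus : 'M[R[i]]_2 := adjoint sigma_minus.
Definition number_op : 'M[R[i]]_2 := sigma_plus *m sigma_minus.

Variables (lambda : R[i]) (kappa : R) (L : nat).

(* The ring [1, L] is represented by 'I_L = {0, .., L-1}; ordS and ord_pred are
   x + 1 and x - 1 modulo L. *)
Definition q_op (x : 'I_L) : operator R L :=
  site_op sigma_minus x *m site_op sigma_minus (ordS x)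
  - lambda *: (site_op sigma_minus (ord_pred x)
               *m site_op sigma_minus (ordS (ordS x))).

Definition H_per : operator R L :=
  \sum_(x < L)
     (site_op number_op x *m site_op number_op (ordS (ordS x))
      + kappa%:C *: (adjoint (q_op x) *m q_op x)).

End Hamiltonian.

Section Gap.
Variables (R : realType) (n : nat).

(* Real eigenvalues; these are all the eigenvalues of a self-adjoint H. The
   library's eigenvalue uses row eigenvectors, but a square matrix has the same
   eigenvalues on either side. *)
Definition spectrum (H : 'M[R[i]]_n) : set R :=
  [set e | eigenvalue H e%:C].

(* The spectrum is finite, so these infima are minima, provided that n > 0 and,
   for the second one, that H has at least two distinct eigenvalues. *)
Definition ground_energy (H : 'M[R[i]]_n) : R := inf (spectrum H).
Definition first_excited_energy (H : 'M[R[i]]_n) : R :=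
  inf (spectrum H `\ ground_energy H).

Definition gap (H : 'M[R[i]]_n) : R :=
  first_excited_energy H - ground_energy H.

End Gap.

Section ThresholdFunction.
Variable R : realType.
Implicit Types (r : R) (n : nat).

Definition beta_plus r : R := (1 + Num.sqrt (1 + 4 * r)) / 2.
Definition beta_minus r : R := (1 - Num.sqrt (1 + 4 * r)) / 2.
Definition beta_ratio r : R := beta_minus r / beta_plus r.

Definition beta_seq r n : R :=
  (beta_plus r)^-1
  * ((1 - beta_ratio r ^+ n) / (1 - beta_ratio r ^+ n.+1)).

Definition f_term n r : R :=
  r * beta_seq r n * beta_seq r (n - 2)
  * ((1 - beta_seq r (n - 1) * (1 + r)) ^+ 2 / (1 + 2 * r)
     + beta_seq r (n - 3)
       * (r * (1 - beta_seq r (n - 1)) ^+ 2 / (1 + r))).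

Definition f_values r : set R := [set f_term n r | n in [set n | (4 <= n)%N]].

Definition f_sup r : R := sup (f_values r).

(* The real-valued sup is only meaningful on nonempty bounded sets. *)
Lemma has_sup_f_values r : 0 <= r -> has_sup (f_values r).
Proof.
move=> r0; split; first by exists (f_term 4 r); exists 4%N.
have bp0 : 0 < beta_plus r.
  by rewrite /beta_plus divr_gt0// ltr_pwDl// sqrtr_ge0.
have c1 : `|beta_ratio r| < 1.
  rewrite /beta_ratio normrM normfV (gtr0_norm bp0) ltr_pdivrMr// mul1r.
  rewrite /beta_minus /beta_plus normrM [X in _ * X]gtr0_norm//.
  rewrite ltr_pM2r//; set s := Num.sqrt _.
  have s1 : 1 <= s.
    by rewrite -sqrtr1 /s ler_sqrt ?lerDl ?mulr_ge0// addr_ge0// mulr_ge0.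
  by rewrite ltr_norml; apply/andP; split; lra.
pose M := (beta_plus r)^-1 * (2 / (1 - `|beta_ratio r|)).
have cX n : `|beta_ratio r ^+ n| <= 1.
  by rewrite normrX exprn_ile1// ltW.
have b_le n : `|beta_seq r n| <= M.
  rewrite /beta_seq /M; move: (beta_ratio r) c1 cX => c c1 cX.
  rewrite !normrM !normfV (gtr0_norm bp0).
  rewrite ler_wpM2l ?invr_ge0 ?(ltW bp0)//.
  apply: ler_pM => //; rewrite ?invr_ge0//.
  - apply: le_trans (ler_normB _ _) _; rewrite normr1.
    by have := cX n; lra.
  - have le1 : `|c ^+ n.+1| <= `|c|.
      by rewrite exprS normrM ler_piMr.
    have le2 : 1 - `|c| <= `|1 - c ^+ n.+1|.
      apply: le_trans (lerB_dist _ _); rewrite normr1; lra.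
    have gt : 0 < 1 - `|c| by lra.
    by rewrite lef_pV2 ?posrE//; exact: lt_le_trans gt le2.
have M0 : 0 <= M by apply: le_trans (b_le 0%N).
move: M b_le M0 => M b_le M0.
exists (r * M * M * ((1 + M * (1 + r)) ^+ 2 / (1 + 2 * r)
                     + M * (r * (1 + M) ^+ 2 / (1 + r)))).
move=> _ [n _ <-]; apply: le_trans (ler_norm _) _.
have r1 : 0 <= 1 + r by rewrite addr_ge0.
have r2 : 0 <= 1 + 2 * r by rewrite addr_ge0// mulr_ge0.
rewrite /f_term.
move: (b_le n) (b_le (n - 2)%N) (b_le (n - 1)%N) (b_le (n - 3)%N).
move: (beta_seq r n) (beta_seq r (n - 2)) (beta_seq r (n - 1))
  (beta_seq r (n - 3)) => a b c d ha hb hc hd.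
rewrite normrM; apply: ler_pM => //.
  rewrite !normrM (ger0_norm r0); apply: ler_pM => //.
    exact: mulr_ge0.
  exact: ler_wpM2l.
apply: le_trans (ler_normD _ _) _; apply: lerD.
  rewrite normrM normfV (ger0_norm r2) normrX ler_wpM2r ?invr_ge0//.
  rewrite lerXn2r ?nnegrE// ?addr_ge0 ?mulr_ge0//.
  apply: le_trans (ler_normB _ _) _.
  by rewrite normr1 lerD2l normrM (ger0_norm r1) ler_wpM2r.
rewrite normrM; apply: ler_pM => //.
rewrite normrM normfV (ger0_norm r1) normrM (ger0_norm r0) normrX.
rewrite ler_wpM2r ?invr_ge0// ler_wpM2l//.
rewrite lerXn2r ?nnegrE ?addr_ge0//.
by apply: le_trans (ler_normB _ _) _; rewrite normr1 lerD2l.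
Qed.

End ThresholdFunction.

Definition gamma_per (R : realType) (lambda : R[i]) (kappa : R) : R :=
  1 / 3 * Num.min 1
    (Num.min (kappa / (2 + 2 * kappa * Normc.normc lambda ^+ 2))
             (kappa / (kappa + 2))).

(* Main.v *)
(* On the ring, the configurations without the patterns 1*1, 11**1, 1**11 and
   11***11 are the tilings obtained from a root configuration, whose particles
   have mutual distance at least 3, by replacing some 1001 by 0110 (dimers).
   On each space of tilings with a common root the Hamiltonian acts, after
   division of the amplitudes by lambda^(number of dimers), as the generator of
   a Glauber dynamics for a one-dimensional hard-core gas of fugacity |lambda|^2.
   On an open chain the martingale method gives the Poincare constant
   2 / (1 - sqrt (3 f))^2, proved by induction on the chain; a ring is reduced
   to open chains by conditioning on each of two adjacent sites.
   An eigenvector that vanishes on all tilings has energy at least gamma_per: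
   each of its configurations contains a pair at distance two or is linked to
   such a configuration by one or two hops, and these hops are used once. *)
Require Import Defs.
From mathcomp Require Import all_boot all_order all_algebra.
From mathcomp Require Import complex zify ring lra.
From mathcomp Require Import all_classical all_reals all_analysis.
From mathcomp Require Import fintype finset.
Import Order.TTheory GRing.Theory Num.Theory.

Set Implicit Arguments.
Unset Strict Implicit.
Unset Printing Implicit Defensive.

Local Open Scope ring_scope.

(** * The threshold function *)

Section Threshold.
Variable R : realType.
Implicit Types (r s : R) (n : nat).

(** A dimer at x uses the root particles at x - 1 and x + 2, so two dimers exclude each other
    exactly when their sites differ by three; this is the hard core. Read at a tiling, the equation
    H psi = e psi involves only tilings with the same root. Hence a single nonzero amplitude on a
    tiling already yields an eigenfunction of the Glauber generator with eigenvalue e, and the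
    Hilbert space is never decomposed. The number beta_(n+1) = Z_(n-1) / Z_n is the probability that
    the end site of a chain of n sites is vacant, and f_n is the factor by which averaging over the
    last two sites shrinks the squared norm of a martingale increment. On the ring, a cut at one
    site c controls the variances given c, but not the variance of the conditional mean. A second
    cut next to c supplies it, because the two cut sites are never occupied together. Off the
    tilings only a pair at distance two has a diagonal energy, which is 1. It is shared out as 1/3 +
    1/6 + 1/6 + 1/3 among its own configuration and those that reach it by hops. *)

Lemma beta_seq0 r : beta_seq r 0 = 0.
Proof. by rewrite /beta_seq expr0 subrr mul0r mulr0. Qed.

(** [beta_plus] and [beta_minus] are the roots of x^2 = x + r, so the closed formula solves the
    recursion of the ratios of the path partition functions, Z_(n+1) = Z_n + r Z_(n-1). *)
Lemma beta_seqS r n : 0 <= r -> beta_seq r n.+1 = (1 + r * beta_seq r n)^-1.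
Proof.
move=> r0; rewrite /beta_seq.
have t1 : 1 <= Num.sqrt (1 + 4 * r).
  rewrite -[leLHS]sqrtr1 ler_sqrt ?lerDl ?mulr_ge0//.
  by rewrite addr_ge0 ?mulr_ge0.
have t2 : Num.sqrt (1 + 4 * r) ^+ 2 = 1 + 4 * r.
  by rewrite sqr_sqrtr ?addr_ge0 ?mulr_ge0.
have P0 : 0 < beta_plus r by rewrite /beta_plus; lra.
have M1 : beta_minus r = beta_ratio r * beta_plus r.
  by rewrite /beta_ratio divfK ?gt_eqF.
have PM : beta_plus r + beta_minus r = 1 by rewrite /beta_plus /beta_minus; lra.
have PMr : beta_plus r * beta_minus r = - r.
  by rewrite /beta_plus /beta_minus; nra.
have c1 : `|beta_ratio r| < 1.
  rewrite /beta_ratio normrM normfV (gtr0_norm P0) ltr_pdivrMr// mul1r.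
  rewrite ltr_norml /beta_plus /beta_minus; apply/andP; split; lra.
have cn k : 1 - beta_ratio r ^+ k.+1 != 0.
  rewrite subr_eq0 eq_sym; apply/eqP => ck; have : `|beta_ratio r ^+ k.+1| < 1.
    by rewrite normrX exprn_ilt1.
  by rewrite ck normr1 ltxx.
have := cn n; have := cn n.+1; rewrite !exprSr.
move: (beta_plus r) (beta_ratio r ^+ n) (beta_ratio r) (beta_minus r) P0 M1 PM PMr c1.
move=> P u c M P0 -> PM PMr c1 h1 h2.
have c0 : 1 + c != 0.
  by rewrite gt_eqF//; move: c1; rewrite ltr_norml => /andP[]; lra.
have PE : P = (1 + c)^-1.
  by apply: (mulIf c0); rewrite mulVf// -[RHS]PM; ring.
have rE : r = - (c / (1 + c) ^+ 2).
  by rewrite -[r]opprK -PMr PE; congr (- _); field.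
rewrite rE PE; field; rewrite ?c0 ?h1 ?h2 //=.
by have -> : (1 + c) * (1 - c ^+ n * c) + - c * (1 - c ^+ n)
  = 1 - c ^+ n * c * c by ring.
Qed.

Lemma beta_seq_bnd r n : 0 <= r -> 0 <= beta_seq r n <= 1.
Proof.
move=> r0; elim: n => [|n /andP[b0 b1]]; first by rewrite beta_seq0 lexx ler01.
have : 0 <= r * beta_seq r n by rewrite mulr_ge0.
rewrite beta_seqS// => t; rewrite invr_ge0 addr_ge0//=.
by rewrite invf_le1 ?ltr_pwDl// lerDl.
Qed.

Lemma beta_seq_gt0 r n : 0 <= r -> 0 < beta_seq r n.+1.
Proof.
move=> r0; rewrite beta_seqS// invr_gt0 ltr_pwDl// mulr_ge0//.
by case/andP: (beta_seq_bnd n r0).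
Qed.

Lemma beta_seqSM r n : 0 <= r -> beta_seq r n.+1 * (1 + r * beta_seq r n) = 1.
Proof.
move=> r0; rewrite beta_seqS// mulVf// gt_eqF// -invr_gt0 -beta_seqS//.
exact: beta_seq_gt0.
Qed.

Lemma beta_seq1 r : 0 <= r -> beta_seq r 1 = 1.
Proof. by move=> r0; rewrite beta_seqS// beta_seq0 mulr0 addr0 invr1. Qed.

(** The two monotonicities need each other: either one at n + 1 follows from the other at n. *)
Lemma beta_seq_mono r s n : 0 <= r -> r <= s ->
  beta_seq s n <= beta_seq r n /\ r * beta_seq r n <= s * beta_seq s n.
Proof.
move=> r0 rs; have s0 := le_trans r0 rs.
elim: n => [|n [IH1 IH2]]; first by rewrite !beta_seq0 !mulr0.
have /andP[br _] := beta_seq_bnd n r0; have /andP[bs _] := beta_seq_bnd n s0.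
have xr : 0 < 1 + r * beta_seq r n by rewrite ltr_pwDl// mulr_ge0.
have xs : 0 < 1 + s * beta_seq s n by rewrite ltr_pwDl// mulr_ge0.
rewrite !beta_seqS//; split; first by rewrite lef_pV2 ?posrE// lerD2l.
rewrite ler_pdivrMr// mulrAC ler_pdivlMr// !mulrDr !mulr1 lerD//.
by rewrite mulrCA ler_wpM2l// ler_wpM2l.
Qed.

(** The definition of f_n mixes increasing and decreasing functions of r; the relation 1 - b_(k+1) =
    r b_(k+1) b_k regroups it into blocks that all increase with r. *)
Lemma f_term_fact r n : 0 <= r ->
  let b k := beta_seq r k in
  f_term n.+4 r = (1 - b n.+4) * (1 - b n.+3) *
    ((1 - b n.+2) * (r / (1 + 2 * r) * (1 + b n.+2 * (r / (1 + r))))).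
Proof.
move=> r0 b; rewrite /f_term /b !subSS !subn0.
have := beta_seq_gt0 n r0.
have := beta_seqS n r0. have := beta_seqS n.+1 r0. 
have := beta_seqS n.+2 r0. have := beta_seqS n.+3 r0.
set b4 := beta_seq r n.+4; set b3 := beta_seq r n.+3; set b2 := beta_seq r n.+2.
set b1 := beta_seq r n.+1; move: (beta_seq r n) => b0.
move=> -> -> -> ? b1p.
have r1 : 1 + r != 0 by rewrite gt_eqF// ltr_pwDl.
have r2 : 1 + 2 * r != 0 by rewrite gt_eqF// ltr_pwDl// mulr_ge0.
have rb : 0 <= r * b1 by rewrite mulr_ge0// ltW.
have rb1 : 0 <= r * (r * b1) by rewrite mulr_ge0.
field; rewrite ?r1 ?r2/=.
by rewrite !gt_eqF//; lra.
Qed.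

Lemma ratio_mono (c r s : R) : 0 <= c -> 0 <= r -> r <= s ->
  r / (1 + c * r) <= s / (1 + c * s).
Proof.
move=> c0 r0 rs; have s0 := le_trans r0 rs.
have xr : 0 < 1 + c * r by rewrite ltr_pwDl// mulr_ge0.
have xs : 0 < 1 + c * s by rewrite ltr_pwDl// mulr_ge0.
by rewrite ler_pdivrMr// mulrAC ler_pdivlMr//; nra.
Qed.

Lemma f_term_mono r s n : 0 <= r -> r <= s -> (4 <= n)%N ->
  f_term n r <= f_term n s.
Proof.
case: n => [|[|[|[|n]]]]// r0 rs _; have s0 := le_trans r0 rs.
rewrite !f_term_fact//.
have m k : beta_seq s k <= beta_seq r k by case: (beta_seq_mono k r0 rs).
have hr k : 0 <= beta_seq r k <= 1 by exact: beta_seq_bnd.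
have hs k : 0 <= beta_seq s k <= 1 by exact: beta_seq_bnd.
have m2 := m n.+2.
have /andP[r2 r2'] := hr n.+2; have /andP[s2 s2'] := hs n.+2.
have d0 (t : R) : 0 <= t -> 0 <= t / (1 + 2 * t).
  by move=> ?; rewrite divr_ge0 ?addr_ge0 ?mulr_ge0.
have c0 (t : R) : 0 <= t -> 0 <= t / (1 + t) <= 1.
  move=> ?; rewrite divr_ge0 ?addr_ge0//= ler_pdivrMr ?ltr_pwDl// mul1r lerDr//.
have dm : r / (1 + 2 * r) <= s / (1 + 2 * s) by exact: ratio_mono.
have cm : r / (1 + r) <= s / (1 + s).
  by have := @ratio_mono 1 r s; rewrite !mul1r; apply.
have dr := d0 _ r0; have ds := d0 _ s0.
have /andP[cr cr'] := c0 _ r0; have /andP[cs cs'] := c0 _ s0.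
have sub1 k : 0 <= 1 - beta_seq r k <= 1 - beta_seq s k.
  by have := m k; have /andP[? ?] := hr k; move=> ?; apply/andP; split; lra.
apply: ler_pM.
- by apply: mulr_ge0; case/andP: (sub1 n.+4); case/andP: (sub1 n.+3).
- apply: mulr_ge0; first by rewrite subr_ge0.
  by apply: mulr_ge0 => //; rewrite addr_ge0// mulr_ge0.
- by apply: ler_pM; case/andP: (sub1 n.+4); case/andP: (sub1 n.+3).
rewrite mulrCA [leRHS]mulrCA; apply: ler_pM => //.
  apply: mulr_ge0; first by rewrite subr_ge0.
  by rewrite addr_ge0// mulr_ge0.
move: (beta_seq r n.+2) (beta_seq s n.+2) (r / (1 + r)) (s / (1 + s))
  m2 r2 r2' s2 s2' cm cr cr' cs cs' => a b c d m2 r2 r2' s2 s2' cm cr cr' cs cs'.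
(* (1 - b)(1 + b c) increases with c and, as c <= 1, decreases with b; the two arguments are changed
   one at a time. *)
apply: (@le_trans _ _ ((1 - a) * (1 + a * d))).
  by rewrite ler_wpM2l ?subr_ge0// lerD2l ler_wpM2l.
rewrite -subr_ge0.
have -> : (1 - b) * (1 + b * d) - (1 - a) * (1 + a * d)
  = (a - b) * (1 - d + d * (a + b)) by ring.
by rewrite mulr_ge0 ?subr_ge0// addr_ge0 ?subr_ge0// mulr_ge0// addr_ge0.
Qed.

Lemma f_sup_ub r n : 0 <= r -> (4 <= n)%N -> f_term n r <= f_sup r.
Proof. by move=> r0 n4; apply: ub_le_sup; [case: (has_sup_f_values r0)|exists n]. Qed.

(** Positivity makes theta = sqrt(3 f) an admissible weight in Young's inequality, where it is
    divided by. *)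
Lemma f_sup_gt0 r : 0 < r -> 0 < f_sup r.
Proof.
move=> r0; have r0' := ltW r0; apply: lt_le_trans (f_sup_ub r0' (leqnn 4)).
have b_lt1 n : 0 < 1 - beta_seq r n.+2.
  have -> : 1 - beta_seq r n.+2 = beta_seq r n.+2 * (r * beta_seq r n.+1).
    by rewrite -[X in X - _](beta_seqSM n.+1 r0'); ring.
  by apply: mulr_gt0; [|apply: mulr_gt0] => //; exact: beta_seq_gt0.
have b0 := beta_seq_gt0 1 r0'.
rewrite f_term_fact//; apply: mulr_gt0; first by apply: mulr_gt0; exact: b_lt1.
apply: mulr_gt0; first exact: b_lt1.
have d1 : 0 < r / (1 + 2 * r) by rewrite divr_gt0// addr_gt0// mulr_gt0.
have d2 : 0 < r / (1 + r) by rewrite divr_gt0// addr_gt0.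
by apply: mulr_gt0 => //; rewrite addr_gt0//; exact: mulr_gt0.
Qed.

Lemma f_sup_mono : {in `[0, +oo[ &, {homo @f_sup R : r s / r <= s}}.
Proof.
move=> r s; rewrite !in_itv/= !andbT => r0 s0 rs.
apply: ge_sup; first by case: (has_sup_f_values r0).
move=> _ [n n4 <-]; apply: le_trans (f_sup_ub s0 n4).
exact: f_term_mono.
Qed.

End Threshold.

(** * Poincare inequality for the hard-core gas on a chain *)

Section FivePoint.
Variable R : realType.

Lemma young (c u v : R) : 0 < c -> u * v <= (c * u ^+ 2 + v ^+ 2 / c) / 2.
Proof.
move=> c0; rewrite -subr_ge0.
have -> : (c * u ^+ 2 + v ^+ 2 / c) / 2 - u * v = (c * u - v) ^+ 2 / c / 2.
  by field; rewrite gt_eqF.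
by rewrite !divr_ge0 ?sqr_ge0 ?ltW.
Qed.

Lemma le_congr (a b c d : R) : c = a -> d = b -> a <= b -> c <= d.
Proof. by move=> -> ->. Qed.

Variables (r theta : R).
Hypotheses (r0 : 0 < r) (th0 : 0 < theta) (th1 : theta < 1).

(* The last three sites z, y, x of a chain carry five hard-core states; the a's
   are the conditional means of an observable given the state (the index lists
   the occupied sites), and b, bs, bt are the conditional probabilities that x,
   y, z are vacant. With U the martingale increment at x and g the conditional
   expectation over {y, x}, X = <a, U> = <a - g a, U> + <g a, g U>. The first
   term is controlled by the hops at y and x, and |g U|^2 = f_n |U|^2. *)
Lemma five_point n (a0 az ay ax axz : R) :
  3 * f_term n.+4 r <= theta ^+ 2 ->
  let b : R := beta_seq r n.+4 in let bs : R := beta_seq r n.+3 in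
  let bt : R := beta_seq r n.+2 in
  let p : R := 1 - b in let ps : R := 1 - bs in let pt : R := 1 - bt in
  let X : R := p * b * (bs * (bt * a0 + pt * az) + ps * ay
                    - (bt * ax + pt * axz)) ^+ 2 in
  let X1 : R := b * (ps * bs * ((bt * a0 + pt * az) - ay) ^+ 2) in
  let X2 : R := b * (bs * (pt * bt * (a0 - az) ^+ 2))
            + p * (pt * bt * (ax - axz) ^+ 2) in
  let e : R := p * (bt * (ax - a0) ^+ 2 + pt * (axz - az) ^+ 2) in
  let e1 : R := b * (ps * (ay - a0) ^+ 2) in
  is_true (X <= (e + e1) / (1 - theta) + theta / 3 * (X + X1 + X2)).
Proof.
move=> hf b bs bt p ps pt X X1 X2 e e1.
have r0' := ltW r0.
pose b1 := beta_seq r n.+1.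
have b1p : 0 < b1 by exact: beta_seq_gt0.
have btp : 0 < bt by exact: beta_seq_gt0.
have bsp : 0 < bs by exact: beta_seq_gt0.
have bp : 0 < b by exact: beta_seq_gt0.
have pE : p = r * b * bs by have := beta_seqSM n.+3 r0'; rewrite -/b -/bs /p; lra.
have psE : ps = r * bs * bt by have := beta_seqSM n.+2 r0'; rewrite -/bs -/bt /ps; lra.
have ptE : pt = r * bt * b1 by have := beta_seqSM n.+1 r0'; rewrite -/bt -/b1 /pt; lra.
have fE : f_term n.+4 r = r * b * bt * ((1 - bs * (1 + r)) ^+ 2 / (1 + 2 * r)
    + b1 * (r * (1 - bs) ^+ 2 / (1 + r))).
  by rewrite /f_term !subSS !subn0.
have bsE : bs = (1 + r * bt)^-1 by rewrite /bs beta_seqS.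
have bE : b = (1 + r * bs)^-1 by rewrite /b beta_seqS.
rewrite fE in hf; clearbody b bs bt b1.
(* By p = r b bs and ps = r bs bt the states empty, {y}, {x}, {z}, {x, z} have probabilities W0, r
   W0, r W0, W1, r W1. [D] is the effect of x on the mean, so U is b D or - p D; [m0], [m1] and
   [c0], [c1] average a and U over {y, x} for z vacant or occupied. *)
pose W0 := b * bs * bt; pose W1 := b * bs * pt.
pose D := bt * ax + pt * axz - (bs * (bt * a0 + pt * az) + ps * ay).
pose m0 := (a0 + r * ay + r * ax) / (1 + 2 * r).
pose m1 := (az + r * axz) / (1 + r).
pose c0 := D * (r / (1 + 2 * r) - p).
pose c1 := D * (r / (1 + r) - p).
pose m := W0 * (a0 + r * ay + r * ax) + W1 * (az + r * axz).
have r1 : 1 + r != 0 by rewrite gt_eqF// addr_gt0.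
have r2 : 1 + 2 * r != 0 by rewrite gt_eqF// addr_gt0// mulr_gt0.
have W0p : 0 < W0 by rewrite /W0 !mulr_gt0.
have ptp : 0 < pt by rewrite ptE !mulr_gt0.
have W1p : 0 < W1 by rewrite /W1 !mulr_gt0.
have Wsum : W0 * (1 + 2 * r) + W1 * (1 + r) = 1.
  rewrite /W0 /W1; have -> : b * bs * bt * (1 + 2 * r) + b * bs * pt * (1 + r)
    = b * bs * (bt + pt) + b * (r * bs * bt) + (r * b * bs) * (bt + pt) by ring.
  by rewrite -psE -pE /ps /p /pt; ring.
have XE : X = p * b * D ^+ 2 by rewrite /X /D; ring.
have pW : p = r * (W0 + W1) by rewrite pE /W0 /W1 /pt; ring.
have SU2 : W0 * ((1 + r) * (p * D) ^+ 2 + r * (b * D) ^+ 2)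
  + W1 * ((p * D) ^+ 2 + r * (b * D) ^+ 2) = X.
  rewrite XE; transitivity
    (D ^+ 2 * (p ^+ 2 * (1 - r * (W0 + W1)) + b ^+ 2 * (r * (W0 + W1)))).
    have -> : 1 - r * (W0 + W1) = W0 * (1 + r) + W1 by lra.
    by ring.
  by rewrite -pW /p; ring.
have n1 : 1 + r * bt != 0 by rewrite gt_eqF// addr_gt0// mulr_gt0.
have n2 : 1 + r * bt + r != 0 by rewrite gt_eqF// !addr_gt0// mulr_gt0.
have {}bE : b = (1 + r * bt) / (1 + r * bt + r).
  by rewrite bE bsE; field; rewrite n1 n2.
have n3 : r * bt != 0 by rewrite gt_eqF// mulr_gt0.
have b1E : b1 = (1 - bt) / (r * bt) by rewrite -/pt ptE [r * bt * b1]mulrC mulfK.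
(* The overall mean [m] may be subtracted because U has mean zero. *)
have Xsplit : X = (W0 * ((a0 - m0) * (- p * D) + r * ((ay - m0) * (- p * D))
                   + r * ((ax - m0) * (b * D)))
   + W1 * ((az - m1) * (- p * D) + r * ((axz - m1) * (b * D))))
   + (W0 * (1 + 2 * r) * ((m0 - m) * c0) + W1 * (1 + r) * ((m1 - m) * c1)).
  rewrite /X /c0 /c1 /m /m0 /m1 /D /W0 /W1 /p /ps /pt bE bsE.
  by field; rewrite ?n1 ?n2 ?r1 ?r2.
have gU : W0 * (1 + 2 * r) * c0 ^+ 2 + W1 * (1 + r) * c1 ^+ 2
  = r * b * bt * ((1 - bs * (1 + r)) ^+ 2 / (1 + 2 * r)
    + b1 * (r * (1 - bs) ^+ 2 / (1 + r))) * X.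
  rewrite XE b1E /c0 /c1 /W0 /W1 /p /pt bE bsE.
  by move: (D) => d; field; rewrite ?n1 ?n2 ?r1 ?r2 ?gt_eqF.
(* Conditioning on z can only lower the variance of a, which is X + X1 + X2. *)
have ZE : W0 * (1 + 2 * r) * (m0 - m) ^+ 2 + W1 * (1 + r) * (m1 - m) ^+ 2
  <= X + X1 + X2.
  have -> : X + X1 + X2 = (W0 * (1 + 2 * r) * (m0 - m) ^+ 2 + W1 * (1 + r) * (m1 - m) ^+ 2)
    + (W0 * ((a0 - m0) ^+ 2 + r * (ay - m0) ^+ 2 + r * (ax - m0) ^+ 2)
   + W1 * ((az - m1) ^+ 2 + r * (axz - m1) ^+ 2)).
    rewrite /X /X1 /X2 /m /m0 /m1 /D /W0 /W1 /p /ps /pt bE bsE.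
    by field; rewrite ?n1 ?n2 ?r1 ?r2.
  rewrite lerDl addr_ge0// mulr_ge0 ?(ltW W0p) ?(ltW W1p)//.
    by rewrite ?addr_ge0 ?sqr_ge0// mulr_ge0 ?sqr_ge0.
  by rewrite addr_ge0 ?sqr_ge0// mulr_ge0 ?sqr_ge0.
(* [e + e1] sums squared deviations from a0 and az; the conditional means m0 and m1 minimise such
   sums. *)
have YE : W0 * ((a0 - m0) ^+ 2 + r * (ay - m0) ^+ 2 + r * (ax - m0) ^+ 2)
   + W1 * ((az - m1) ^+ 2 + r * (axz - m1) ^+ 2) <= e + e1.
  have -> : e + e1 = (W0 * ((a0 - m0) ^+ 2 + r * (ay - m0) ^+ 2 + r * (ax - m0) ^+ 2)
   + W1 * ((az - m1) ^+ 2 + r * (axz - m1) ^+ 2))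
   + (W0 * (1 + 2 * r) * (a0 - m0) ^+ 2 + W1 * (1 + r) * (az - m1) ^+ 2).
    rewrite /e /e1 /m0 /m1 /W0 /W1 /p /ps /pt bE bsE.
    by field; rewrite ?n1 ?n2 ?r1 ?r2.
  rewrite lerDl addr_ge0// mulr_ge0 ?sqr_ge0//.
    by rewrite mulr_ge0 ?(ltW W0p)// addr_ge0// mulr_ge0.
  by rewrite mulr_ge0 ?(ltW W1p)// addr_ge0.
have th1' : 0 < 1 - theta by rewrite subr_gt0.
have th3 : 0 < theta / 3 by rewrite divr_gt0.
have wy (t w u v : R) : 0 < t -> 0 <= w ->
    w * (u * v) <= (t * (w * v ^+ 2) + w * u ^+ 2 / t) / 2.
  move=> t0 w0; have -> : (t * (w * v ^+ 2) + w * u ^+ 2 / t) / 2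
    = w * ((t * v ^+ 2 + u ^+ 2 / t) / 2) by ring.
  by rewrite ler_wpM2l// [u * v]mulrC young.
have rW0 : 0 <= W0 * r by rewrite mulr_ge0 ?ltW.
have rW1 : 0 <= W1 * r by rewrite mulr_ge0 ?ltW.
have V0 : 0 <= W0 * (1 + 2 * r) by rewrite mulr_ge0 ?ltW// addr_gt0// mulr_gt0.
have V1 : 0 <= W1 * (1 + r) by rewrite mulr_ge0 ?ltW// addr_gt0.
have B1 := wy _ W0 (a0 - m0) (- p * D) th1' (ltW W0p).
have B2 := wy _ (W0 * r) (ay - m0) (- p * D) th1' rW0.
have B3 := wy _ (W0 * r) (ax - m0) (b * D) th1' rW0.
have B4 := wy _ W1 (az - m1) (- p * D) th1' (ltW W1p).
have B5 := wy _ (W1 * r) (axz - m1) (b * D) th1' rW1.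
have C1 := wy _ (W0 * (1 + 2 * r)) c0 (m0 - m) th3 V0.
have C2 := wy _ (W1 * (1 + r)) c1 (m1 - m) th3 V1.
(* Young's inequality with weight 1 - theta on S1 and theta / 3 on S2 returns X / 2 in total, by 3
   f_n <= theta^2. The other half of X remains on the left, which doubles the remaining terms. *)
set S1 := W0 * _ + _ in Xsplit; set S2 := W0 * (1 + 2 * r) * _ + _ in Xsplit.
have S1_le : S1 <= ((1 - theta) * X + (e + e1) / (1 - theta)) / 2.
  apply: (@le_trans _ _ (((1 - theta) * X + (W0 * ((a0 - m0) ^+ 2 + r * (ay - m0) ^+ 2
     + r * (ax - m0) ^+ 2) + W1 * ((az - m1) ^+ 2 + r * (axz - m1) ^+ 2))
     / (1 - theta)) / 2)).
    have := lerD (lerD (lerD (lerD B1 B2) B3) B4) B5.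
    rewrite -SU2 /S1; move: (1 - theta)^-1 => i1.
    by apply: le_congr; ring.
  by rewrite ler_wpM2r// lerD2l ler_wpM2r// invr_ge0 ltW.
have S2_le : S2 <= (theta * X + theta / 3 * (X + X1 + X2)) / 2.
  apply: (@le_trans _ _ ((theta / 3 * (W0 * (1 + 2 * r) * (m0 - m) ^+ 2
      + W1 * (1 + r) * (m1 - m) ^+ 2)
      + (W0 * (1 + 2 * r) * c0 ^+ 2 + W1 * (1 + r) * c1 ^+ 2) / (theta / 3)) / 2)).
    rewrite /S2; have := lerD C1 C2; move: (theta / 3)^-1 => i1.
    by apply: le_congr; ring.
  rewrite ler_wpM2r// addrC; apply: lerD; last by rewrite ler_wpM2l// ltW.
  have X0 : 0 <= X.
    rewrite -SU2 addr_ge0//; apply: mulr_ge0 (ltW _) _ => //.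
      by rewrite addr_ge0// mulr_ge0 ?sqr_ge0// addr_ge0.
    by rewrite addr_ge0 ?sqr_ge0// mulr_ge0 ?sqr_ge0.
  rewrite gU ler_pdivrMr//.
  have -> : theta * X * (theta / 3) = theta ^+ 2 / 3 * X by ring.
  by rewrite ler_wpM2r// ler_pdivlMr// mulrC.
lra.
Qed.

End FivePoint.

(** * Hard-core sums and the Dirichlet form on a finite graph *)

Section HardCore.
Variables (R : realType) (T : finType) (adj : rel T).
Hypotheses (adjC : symmetric adj) (adjxx : irreflexive adj).
Variable r : R.
Implicit Types (A D : {set T}) (F : {set T} -> R).

Definition nbrs x : {set T} := [set y | adj x y].

Definition indep D := [forall x in D, forall y in D, ~~ adj x y].

Definition occupy x F D := F (x |: D).

Definition hsum A F : R :=
  \sum_(D : {set T} | (D \subset A) && indep D) r ^+ #|D| * F D.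

Definition dirichlet A F : R :=
  \sum_(x in A) r * hsum (A :\ x :\: nbrs x) (fun D => (occupy x F D - F D) ^+ 2).

Lemma indepP D : reflect {in D &, forall x y, ~~ adj x y} (indep D).
Proof.
apply: (iffP forall_inP) => h x.
  by move=> y xD yD; have /forall_inP := h x xD; exact.
by move=> xD; apply/forall_inP => y yD; exact: h.
Qed.

Lemma indepU1 x D : indep (x |: D) = indep D && [disjoint D & nbrs x].
Proof.
apply/indepP/andP => [h|[/indepP h /pred0P d] y z].
  split; first by apply/indepP => y z yD zD; apply: h; rewrite !inE ?yD ?zD orbT.
  apply/pred0P => y /=; rewrite inE; apply/negbTE; rewrite negb_and orbC -implybE.
  apply/implyP => xy; apply/negP => yD.
  by move: (h x y); rewrite !inE eqxx yD orbT xy => /(_ isT isT).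
have dE y' : y' \in D -> ~~ adj x y'.
  by move=> yD; have := d y'; rewrite /= inE yD /= => ->.
rewrite !inE => /orP[/eqP->|yD] /orP[/eqP->|zD].
- by rewrite adjxx.
- exact: dE.
- by rewrite adjC dE.
- exact: h.
Qed.

Lemma subset_rem x A D : x \in A ->
  (x |: D \subset A) && indep (x |: D) && (x \notin D)
  = (D \subset A :\ x :\: nbrs x) && indep D.
Proof.
move=> xA; rewrite indepU1 subUset sub1set xA subsetD subsetD1 /=.
by rewrite -!andbA; congr (_ && _); do 2!bool_congr; rewrite andbC.
Qed.

Lemma hsum_rec x A F : x \in A ->
  hsum A F = hsum (A :\ x) F + r * hsum (A :\ x :\: nbrs x) (occupy x F).
Proof.
move=> xA; rewrite /hsum (bigID (fun D => x \in D)) /= addrC; congr (_ + _).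
  by apply: eq_bigl => D; rewrite subsetD1 andbAC.
rewrite (reindex_onto (fun D => x |: D) (fun D => D :\ x)) /=; last first.
  by move=> D /andP[_ xD]; rewrite setD1K.
rewrite big_distrr /=; apply: eq_big => [D|D].
  rewrite -subset_rem// setU11 andbT; congr (_ && _).
  apply/eqP/idP => [<-|xD]; first by rewrite !inE eqxx.
  by rewrite setU1K.
move=> /andP[_ /eqP h]; have xD : x \notin D by rewrite -h !inE eqxx.
by rewrite cardsU1 xD exprS mulrA.
Qed.

Lemma hsum0 F : hsum set0 F = F set0.
Proof.
rewrite /hsum (big_pred1 set0) ?cards0 ?expr0 ?mul1r// => D.
rewrite /= subset0; case: eqP => //= ->.
by apply/indepP => x y; rewrite inE.
Qed.

Lemma eq_hsum A F G : (forall D, D \subset A -> indep D -> F D = G D) ->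
  hsum A F = hsum A G.
Proof. by move=> FG; apply: eq_bigr => D /andP[? ?]; rewrite FG. Qed.

Lemma hsumD A F G : hsum A (fun D => F D + G D) = hsum A F + hsum A G.
Proof. by rewrite /hsum -big_split; apply: eq_bigr => D _; rewrite mulrDr. Qed.

Lemma hsumZ A c F : hsum A (fun D => c * F D) = c * hsum A F.
Proof. by rewrite /hsum big_distrr; apply: eq_bigr => D _; rewrite mulrCA. Qed.

(** A hop at a site not adjacent to x is split by the occupation of x. A hop at a neighbour of x
    requires x vacant, so it occurs only in the first term. The last term is the hop at x itself. *)
Lemma dirichlet_rec x A F : x \in A ->
  dirichlet A F = dirichlet (A :\ x) F
    + r * dirichlet (A :\ x :\: nbrs x) (occupy x F)
    + r * hsum (A :\ x :\: nbrs x) (fun D => (occupy x F D - F D) ^+ 2).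
Proof.
move=> xA; rewrite /dirichlet (bigD1 x) //= addrC; congr (_ + _).
transitivity (\sum_(y in A :\ x) (r * hsum (A :\ x :\ y :\: nbrs y)
    (fun D => (occupy y F D - F D) ^+ 2) +
   (if y \in A :\ x :\: nbrs x then r * (r * hsum (A :\ x :\: nbrs x :\ y :\: nbrs y)
    (fun D => (occupy y (occupy x F) D - occupy x F D) ^+ 2)) else 0))).
  apply: eq_big => [y|y /andP[yA yx]]; first by rewrite !inE andbC.
  rewrite !inE yA yx !andbT; case: ifPn => xy.
    rewrite (@hsum_rec x); last by rewrite !inE xA eq_sym yx adjC xy.
    rewrite mulrDr; congr (r * hsum _ _ + r * (r * _)).
    - apply/setP => z; rewrite !inE; case: (adj y z); case: (adj x z);
        by case: (z == x); case: (z == y); case: (z \in A).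
    - rewrite (_ : A :\ y :\: nbrs y :\ x :\: nbrs x
        = A :\ x :\: nbrs x :\ y :\: nbrs y); last first.
        apply/setP => z; rewrite !inE; case: (adj y z); case: (adj x z);
          by case: (z == x); case: (z == y); case: (z \in A).
      by apply: eq_hsum => D _ _; rewrite /occupy setUCA.
  rewrite addr0; congr (r * hsum _ _); apply/setP => z; rewrite !inE.
  case: (z =P x) => [->|]; rewrite ?andbT//=.
  by rewrite adjC; move: xy; rewrite negbK => ->.
rewrite big_split /=; congr (_ + _).
rewrite big_distrr /= [RHS]big_mkcond /= [LHS]big_mkcond /=.
by apply: eq_bigr => y _; rewrite !inE; case: (y == x) => //=;
  case: (y \in A); rewrite ?andbF.
Qed.

Hypothesis r0 : 0 < r.

Lemma hsum_ge0 A F : (forall D, D \subset A -> 0 <= F D) -> 0 <= hsum A F.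
Proof.
move=> F0; apply: sumr_ge0 => D /andP[DA _].
by rewrite mulr_ge0 ?F0// exprn_ge0// ltW.
Qed.

Definition part_fun A := hsum A (fun=> 1).

Lemma hsum_cst A c : hsum A (fun=> c) = c * part_fun A.
Proof. by rewrite -hsumZ; apply: eq_hsum => D _ _; rewrite mulr1. Qed.

Lemma part_fun_gt0 A : 0 < part_fun A.
Proof.
rewrite /part_fun /hsum (bigD1 set0) /=; last first.
  by rewrite sub0set; apply/indepP => x y; rewrite inE.
rewrite cards0 expr0 mul1r ltr_pwDl// sumr_ge0// => D _.
by rewrite mulr1 exprn_ge0// ltW.
Qed.

Lemma hsum_sqr_ge A F :
  hsum A F ^+ 2 / part_fun A <= hsum A (fun D => F D ^+ 2).
Proof.
have Z0 := part_fun_gt0 A; set Z := part_fun A in Z0 *.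
pose m := hsum A F / Z.
have := @hsum_ge0 A (fun D => (F D - m) ^+ 2) (fun D _ => sqr_ge0 _).
have -> : hsum A (fun D => (F D - m) ^+ 2)
  = hsum A (fun D => F D ^+ 2) + ((- (2 * m)) * hsum A F + m ^+ 2 * Z).
  rewrite -hsumZ -hsum_cst -!hsumD; apply: eq_hsum => D _ _; ring.
have -> : - (2 * m) * hsum A F + m ^+ 2 * Z = - (hsum A F ^+ 2 / Z).
  by rewrite /m; field; rewrite gt_eqF.
by rewrite subr_ge0.
Qed.

End HardCore.

(** * The martingale recursion on open chains *)

Section Chain.
Variables (R : realType) (T : finType) (adj : rel T).
Hypotheses (adjC : symmetric adj) (adjxx : irreflexive adj).
Variable r : R.
Hypothesis r0 : 0 < r.
Implicit Types (F : {set T} -> R) (s : seq T).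

(* What is left of s once x, which precedes s, is occupied. *)
Definition free_tail x s :=
  if s is y :: s' then if adj x y then s' else s else [::].

(* An elimination order for a disjoint union of paths. *)
Fixpoint chainlike s :=
  if s is x :: s' then
    [&& x \notin s', all (fun y => ~~ adj x y) (behead s') & chainlike s']
  else true.

(* The length of the initial path of s. *)
Fixpoint run s : nat :=
  if s is x :: s' then
    (if s' is y :: _ then if adj x y then run s' else 0%N else 0%N).+1
  else 0%N.

Definition sset s : {set T} := [set x in s].
Notation Z s := (part_fun adj r (sset s)).

Lemma chainlike_free_tail x s : chainlike (x :: s) -> chainlike (free_tail x s).
Proof.
case: s => [|y s] //= /and3P[_ _] /and3P[? ? ?].
by case: ifP => //= _; apply/and3P; split.
Qed.

Lemma sset_cons x s : chainlike (x :: s) -> sset (x :: s) :\ x = sset s.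
Proof.
move=> /= /and3P[xs _ _]; apply/setP => y; rewrite !inE.
by case: eqP => [->|]//=; rewrite (negPf xs).
Qed.

Lemma sset_free_tail x s : chainlike (x :: s) ->
  sset (x :: s) :\ x :\: nbrs adj x = sset (free_tail x s).
Proof.
move=> ls; rewrite (sset_cons ls); case: s ls => [|y s] ls.
  by apply/setP => z; rewrite !inE andbF.
case/and3P: ls => /= xs a ls.
have sy z : z \in s -> ~~ adj x z by move/allP: a; apply.
case/andP: ls => ys _.
case: ifP => xy; apply/setP => z; rewrite !inE.
  case: eqP => [->|] /=; first by rewrite xy (negPf ys).
  by case: (boolP (z \in s)) => [/sy ->|]; rewrite ?andbF.
case: eqP => [->|] /=; first by rewrite xy.
by case: (boolP (z \in s)) => [/sy ->|]; rewrite ?andbF.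
Qed.

Definition mean s F := hsum adj r (sset s) F / Z s.
Definition dirn s F := dirichlet adj r (sset s) F / Z s.
Definition var s F := mean s (fun D => F D ^+ 2) - mean s F ^+ 2.
(** For an initial path of n sites this is Z_(n-1) / Z_n = beta_(n+1), hence the shift by one; the
    later components cancel in the ratio. On the empty list the value is beta_1 = 1. *)
Definition vacancy s : R := beta_seq r (run s).+1.

Lemma part_fun_cons x s : chainlike (x :: s) -> Z (x :: s) = Z s + r * Z (free_tail x s).
Proof.
move=> ls; have xs : x \in sset (x :: s) by rewrite !inE eqxx.
by rewrite /part_fun (hsum_rec adjC adjxx _ _ xs) sset_free_tail// sset_cons.
Qed.

Lemma vacancyE x s : chainlike (x :: s) -> Z s / Z (x :: s) = vacancy (x :: s).
Proof.
have Z0 s' : 0 < Z s' by exact: part_fun_gt0.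
elim: s x => [|y s IH] x ls; rewrite (part_fun_cons ls) /vacancy.
  rewrite /= beta_seqS ?ltW// beta_seq1 ?ltW//.
  by field; rewrite !gt_eqF//= ?addr_gt0 ?mulr_gt0.
have ls' : chainlike (y :: s) by case/and3P: ls.
move: (IH y ls'); rewrite /vacancy /=; case: ifP => xy IHy.
  rewrite beta_seqS ?ltW// -IHy; field.
  by rewrite !gt_eqF//= ?addr_gt0 ?mulr_gt0.
rewrite beta_seqS ?ltW// beta_seq1 ?ltW//.
by field; rewrite !gt_eqF//= ?addr_gt0 ?mulr_gt0.
Qed.

Lemma mean_cons x s F : chainlike (x :: s) ->
  mean (x :: s) F = vacancy (x :: s) * mean s F
                    + (1 - vacancy (x :: s)) * mean (free_tail x s) (occupy x F).
Proof.
move=> ls; have xs : x \in sset (x :: s) by rewrite !inE eqxx.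
rewrite /mean -vacancyE// (hsum_rec adjC adjxx _ _ xs) sset_free_tail// sset_cons//.
rewrite (part_fun_cons ls).
have Z0 s' : 0 < Z s' by exact: part_fun_gt0.
field.
by rewrite !gt_eqF//= ?addr_gt0 ?mulr_gt0.
Qed.

Lemma dirn_cons x s F : chainlike (x :: s) ->
  dirn (x :: s) F = vacancy (x :: s) * dirn s F
    + (1 - vacancy (x :: s)) * dirn (free_tail x s) (occupy x F)
    + (1 - vacancy (x :: s)) * mean (free_tail x s) (fun D => (occupy x F D - F D) ^+ 2).
Proof.
move=> ls; have xs : x \in sset (x :: s) by rewrite !inE eqxx.
rewrite /mean /dirn -vacancyE// (dirichlet_rec adjC adjxx _ _ xs).
rewrite sset_free_tail// sset_cons//.
rewrite (part_fun_cons ls).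
have Z0 s' : 0 < Z s' by exact: part_fun_gt0.
by field; rewrite !gt_eqF//= ?addr_gt0 ?mulr_gt0.
Qed.

Lemma vacancy_bnd s : 0 < vacancy s <= 1.
Proof.
have r0' := ltW r0; rewrite /vacancy beta_seq_gt0//=.
by case/andP: (beta_seq_bnd (run s).+1 r0').
Qed.

Lemma mean_ge0 s F : (forall D, 0 <= F D) -> 0 <= mean s F.
Proof.
by move=> F0; rewrite divr_ge0 ?hsum_ge0// ltW// part_fun_gt0.
Qed.

Lemma mean_sqr s F : mean s F ^+ 2 <= mean s (fun D => F D ^+ 2).
Proof.
have Z0 := part_fun_gt0 adj r0 (sset s).
rewrite /mean.
have -> : (hsum adj r (sset s) F / Z s) ^+ 2
  = hsum adj r (sset s) F ^+ 2 / Z s / Z s by field; rewrite gt_eqF.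
by rewrite ler_wpM2r ?invr_ge0 ?(ltW Z0)// hsum_sqr_ge.
Qed.

Lemma meanB s F G : mean s (fun D => F D - G D) = mean s F - mean s G.
Proof.
rewrite /mean -mulrBl; congr (_ / _); rewrite -[X in _ = _ + X]mulN1r -hsumZ -hsumD.
by apply: eq_hsum => D _ _; rewrite mulN1r.
Qed.

Lemma mean_sqrB s F G :
  (mean s F - mean s G) ^+ 2 <= mean s (fun D => (F D - G D) ^+ 2).
Proof. by rewrite -meanB; exact: mean_sqr. Qed.

(* Contributions of the first site of s to the Dirichlet form and to the
   martingale decomposition of the variance; jump2 is the contribution of the
   second site when the first one is vacant. *)
Definition edge s F : R :=
  if s is x :: s' then
    (1 - vacancy s) * mean (free_tail x s') (fun D => (occupy x F D - F D) ^+ 2) else 0.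
Definition jump s F : R :=
  if s is x :: s' then
    (1 - vacancy s) * vacancy s *
      (mean s' F - mean (free_tail x s') (occupy x F)) ^+ 2 else 0.
Definition jump2 s F : R :=
  if s is x :: s' then vacancy s * jump s' F else 0.

(** The law of total variance, given the occupation of x. *)
Lemma var_cons x s F : chainlike (x :: s) ->
  var (x :: s) F = vacancy (x :: s) * var s F
    + (1 - vacancy (x :: s)) * var (free_tail x s) (occupy x F) + jump (x :: s) F.
Proof. by move=> ls; rewrite /var /jump !mean_cons//; rewrite /occupy; ring. Qed.

Lemma edge_ge0 s F : 0 <= edge s F.
Proof.
case: s => [|x s] //=; apply: mulr_ge0; last by apply: mean_ge0 => D; rewrite sqr_ge0.
by rewrite subr_ge0; case/andP: (vacancy_bnd (x :: s)).
Qed.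

Lemma jump_ge0 s F : 0 <= jump s F.
Proof.
case: s => [|x s] //=; rewrite mulr_ge0 ?sqr_ge0// mulr_ge0 ?subr_ge0//;
by case/andP: (vacancy_bnd (x :: s)) => // /ltW.
Qed.

Lemma jump2_ge0 s F : 0 <= jump2 s F.
Proof.
case: s => [|x s] //=; rewrite mulr_ge0 ?jump_ge0//.
by case/andP: (vacancy_bnd (x :: s)) => // /ltW.
Qed.

Variable theta : R.
Hypotheses (th0 : 0 < theta) (th1 : theta < 1).
Hypothesis f_le : forall n, (4 <= n)%N -> 3 * f_term n r <= theta ^+ 2.

(** This is [five_point] when the initial path has at least three sites. On a shorter one the edges
    alone dominate the jump, 1 / (1 - theta) being at least 1. *)
Lemma jump_le x s F : chainlike (x :: s) ->
  jump (x :: s) F <= (edge (x :: s) F + vacancy (x :: s) * edge s F) / (1 - theta)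
   + theta / 3 * (jump (x :: s) F + vacancy (x :: s) * jump s F
       + (vacancy (x :: s) * jump2 s F
          + (1 - vacancy (x :: s)) * jump (free_tail x s) (occupy x F))).
Proof.
move=> ls; have th1' : 0 < 1 - theta by rewrite subr_gt0.
have le_div c : 0 <= c -> c <= c / (1 - theta).
  by move=> c0; rewrite ler_pdivlMr// mulrBr mulr1 lerBlDr lerDl mulr_ge0// ltW.
have tail_ge0 : 0 <= theta / 3 * (jump (x :: s) F + vacancy (x :: s) * jump s F
       + (vacancy (x :: s) * jump2 s F
          + (1 - vacancy (x :: s)) * jump (free_tail x s) (occupy x F))).
  have /andP[/ltW b0 b1] := vacancy_bnd (x :: s).
  have p0 : 0 <= 1 - vacancy (x :: s) by rewrite subr_ge0.
  have [j1 j2 j3 j4] := And4 (jump_ge0 (x :: s) F) (jump_ge0 s F)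
    (jump2_ge0 s F) (jump_ge0 (free_tail x s) (occupy x F)).
  rewrite mulr_ge0 ?divr_ge0 ?(ltW th0)//.
  by apply: addr_ge0; apply: addr_ge0 => //; apply: mulr_ge0.
have easy : jump (x :: s) F <= edge (x :: s) F + vacancy (x :: s) * edge s F ->
  jump (x :: s) F <= (edge (x :: s) F + vacancy (x :: s) * edge s F) / (1 - theta)
   + theta / 3 * (jump (x :: s) F + vacancy (x :: s) * jump s F
       + (vacancy (x :: s) * jump2 s F
          + (1 - vacancy (x :: s)) * jump (free_tail x s) (occupy x F))).
  move=> h; apply: le_trans h _; apply: le_trans (le_div _ _) _; last by rewrite lerDl.
  have /andP[/ltW b0 b1] := vacancy_bnd (x :: s).
  by apply: addr_ge0; rewrite ?edge_ge0// mulr_ge0 ?edge_ge0.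
have same : free_tail x s = s ->
    jump (x :: s) F <= edge (x :: s) F + vacancy (x :: s) * edge s F.
  move=> nE; have /andP[/ltW b0 b1] := vacancy_bnd (x :: s).
  apply: le_trans (_ : edge (x :: s) F <= _); last first.
    by rewrite lerDl mulr_ge0// edge_ge0.
  rewrite /jump /edge nE -mulrA ler_wpM2l ?subr_ge0//.
  apply: le_trans (mean_sqrB _ _ _).
  have -> : (mean s (occupy x F) - mean s F) ^+ 2
    = 1 * (mean s F - mean s (occupy x F)) ^+ 2 by ring.
  by rewrite ler_wpM2r ?sqr_ge0.
case: s ls tail_ge0 easy same => [|y t] ls tail_ge0 easy same.
  by apply/easy/same.
have [xy|xy] := boolP (adj x y); last by apply/easy/same; rewrite /= (negPf xy).
have nE : free_tail x (y :: t) = t by rewrite /= xy.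
have lt : chainlike (y :: t) by case/and3P: ls.
have [tE|] := boolP ((t == [::]) || (if t is z :: _ then ~~ adj y z else true)).
  have {tE} nE' : free_tail y t = t.
    by case: (t) tE => //= z u; case: ifP.
  apply: easy; rewrite /jump /edge nE nE' mean_cons// nE'.
  have /andP[/ltW b0 b1] := vacancy_bnd [:: x, y & t].
  have /andP[/ltW c0 c1] := vacancy_bnd (y :: t).
  have := mean_sqrB t (occupy x F) F; have := mean_sqrB t (occupy y F) F.
  move: (vacancy [:: x, y & t]) (vacancy (y :: t)) (mean t F) (mean t (occupy x F))
    (mean t (occupy y F)) (mean t (fun D => (occupy x F D - F D) ^+ 2))
    (mean t (fun D => (occupy y F D - F D) ^+ 2)) b0 b1 c0 c1.
  move=> b c m0 mx my ex ey b0 b1 c0 c1 ley lex.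
  (* The middle term is the second moment about m0, the mean with x and y vacant. It exceeds the
     variance due to x by the squared offset of the overall mean and the variance due to y. *)
  apply: (@le_trans _ _ ((1 - b) * (mx - m0) ^+ 2 + b * ((1 - c) * (my - m0) ^+ 2))).
    rewrite -subr_ge0.
    have -> : (1 - b) * (mx - m0) ^+ 2 + b * ((1 - c) * (my - m0) ^+ 2)
      - (1 - b) * b * (c * m0 + (1 - c) * my - mx) ^+ 2
      = ((1 - b) * (mx - m0) + b * (1 - c) * (my - m0)) ^+ 2
        + b * (1 - c) * c * (my - m0) ^+ 2 by ring.
    by rewrite addr_ge0 ?sqr_ge0// mulr_ge0 ?sqr_ge0// !mulr_ge0// subr_ge0.
  apply: lerD; first by rewrite ler_wpM2l// subr_ge0.
  by rewrite ler_wpM2l// ler_wpM2l// subr_ge0.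
case: t ls lt nE {tail_ge0 easy same} => [|z u] // ls lt nE; rewrite orFb negbK => yz.
have lt' : chainlike (z :: u) by case/and3P: lt.
have runE : exists n, run (z :: u) = n.+1.
  by rewrite /=; eexists.
have [n nE'] := runE.
have uE : free_tail y (z :: u) = u by rewrite /= yz.
have hz : vacancy (z :: u) = beta_seq r n.+2 by rewrite /vacancy nE'.
have hy : vacancy [:: y, z & u] = beta_seq r n.+3.
  by rewrite /vacancy; congr (beta_seq r _.+1); rewrite -nE' [LHS]/= yz.
have hx : vacancy [:: x, y, z & u] = beta_seq r n.+4.
  by rewrite /vacancy; congr (beta_seq r _.+1); rewrite -nE' [LHS]/= yz xy.
have := five_point r0 th0 th1 (mean u F) (mean (free_tail z u) (occupy z F))
  (mean u (occupy y F)) (mean u (occupy x F))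
  (mean (free_tail z u) (occupy z (occupy x F))) (f_le (isT : (4 <= n.+4)%N)).
rewrite -hz -hy -hx => fp; cbv zeta in fp.
have [hx0 hx1] := andP (vacancy_bnd [:: x, y, z & u]).
have [hy0 hy1] := andP (vacancy_bnd [:: y, z & u]).
have [hz0 hz1] := andP (vacancy_bnd (z :: u)).
rewrite nE /jump2 /jump /edge nE uE.
rewrite !(mean_cons _ lt) uE !(mean_cons _ lt').
(* Jensen's inequality turns the squared differences of conditional means in [five_point] into
   edges. *)
have le1 := mean_sqrB u (occupy x F) F.
have le2 := mean_sqrB (free_tail z u) (occupy z (occupy x F)) (occupy z F).
have le3 := mean_sqrB u (occupy y F) F.
apply: (le_trans fp); apply: lerD => //.
rewrite ler_wpM2r ?invr_ge0 ?(ltW th1')//; apply: lerD.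
  by rewrite ler_wpM2l ?subr_ge0// lerD// ler_wpM2l// ?subr_ge0// ltW.
by rewrite !ler_wpM2l ?subr_ge0// ltW.
Qed.

(* Along the induction jump_le uses each edge twice and each jump three times;
   the last two terms on the left account for the uses still to come. *)
Lemma chain_poincare_aux s F : chainlike s ->
  (1 - theta) * var s F + theta / 3 * (2 * jump s F + jump2 s F)
   + edge s F / (1 - theta) <= 2 * dirn s F / (1 - theta).
Proof.
have th1' : 0 < 1 - theta by rewrite subr_gt0.
have [n] := ubnP (size s); elim: n s F => // n IH [|x s] F sn ls.
  rewrite /dirn /dirichlet big1 => [|y]; last by rewrite inE.
  rewrite /var /mean (_ : sset [::] = set0); last by apply/setP => y; rewrite !inE.
  by rewrite /part_fun !hsum0 /= !divr1 subrr !mulr0 !addr0 !mul0r mulr0 addr0.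
have lt := chainlike_free_tail ls.
have ls' : chainlike s by case/and3P: ls.
have sz : (size (free_tail x s) <= size s)%N by case: (s) => //= y t; case: ifP => //=.
have {IH} := (IH s F sn ls', IH (free_tail x s) (occupy x F) (leq_ltn_trans sz sn) lt).
move=> [IH1 IH2]; have := jump_le F ls; rewrite var_cons// dirn_cons//.
have -> : jump2 (x :: s) F = vacancy (x :: s) * jump s F by [].
have -> : (1 - vacancy (x :: s)) * mean (free_tail x s) (fun D => (occupy x F D - F D) ^+ 2)
  = edge (x :: s) F by [].
have /andP[b0 b1] := vacancy_bnd (x :: s).
move: (jump_ge0 (free_tail x s) (occupy x F)) (jump_ge0 (x :: s) F)
  (edge_ge0 (x :: s) F) (jump2_ge0 s F) (edge_ge0 s F)
  (jump2_ge0 (free_tail x s) (occupy x F)) (edge_ge0 (free_tail x s) (occupy x F))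
  IH1 IH2 b0 b1.
move: (vacancy (x :: s)) (jump (x :: s) F) (edge (x :: s) F) (jump2 s F) (edge s F)
  (jump2 (free_tail x s) (occupy x F)) (edge (free_tail x s) (occupy x F))
  (jump s F) (jump (free_tail x s) (occupy x F)) (var s F)
  (var (free_tail x s) (occupy x F)) (dirn s F) (dirn (free_tail x s) (occupy x F)).
have i0 : 0 < (1 - theta)^-1 by rewrite invr_gt0.
move: ((1 - theta)^-1) i0 => i i0.
move=> b j0 e0 j2s es j2n en js jn vs vn ds dn h0 h1 h2 h3 h4 h5 h6 IH1 IH2 b0 b1.
have p0 : 0 <= 1 - b by lra.
have {}IH1 := ler_wpM2l (ltW b0) IH1; have {}IH2 := ler_wpM2l p0 IH2.
have q1 : 0 <= theta / 3 * ((1 - b) * j2n).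
  by rewrite !mulr_ge0 ?invr_ge0 ?ler0n// ltW.
have q2 : 0 <= (1 - b) * en * i by rewrite !mulr_ge0// ltW.
have q3 : 0 <= theta / 3 * ((1 - b) * jn).
  by rewrite !mulr_ge0 ?invr_ge0 ?ler0n// ltW.
by move=> key; lra.
Qed.

(** Variance times partition function; unnormalised, so that the parts with a site vacant and
    occupied add up with weights 1 and r. *)
Definition cvar A F :=
  hsum adj r A (fun D => F D ^+ 2) - hsum adj r A F ^+ 2 / part_fun adj r A.

Lemma chain_poincare s F : chainlike s ->
  cvar (sset s) F <= 2 / (1 - theta) ^+ 2 * dirichlet adj r (sset s) F.
Proof.
move=> ls; have Z0 := part_fun_gt0 adj r0 (sset s).
have th1' : 0 < 1 - theta by rewrite subr_gt0.
have -> : cvar (sset s) F = Z s * var s F.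
  by rewrite /cvar /var /mean; field; rewrite gt_eqF.
have -> : dirichlet adj r (sset s) F = Z s * dirn s F.
  by rewrite /dirn mulrC divfK// gt_eqF.
rewrite mulrCA ler_wpM2l ?(ltW Z0)//.
have : (1 - theta) * var s F <= 2 * dirn s F / (1 - theta).
  apply: le_trans (chain_poincare_aux F ls).
  have j1 := jump_ge0 s F; have j2 := jump2_ge0 s F.
  have e0 : 0 <= edge s F / (1 - theta) by rewrite divr_ge0 ?edge_ge0// ltW.
  have : 0 <= theta / 3 * (2 * jump s F + jump2 s F).
    by rewrite mulr_ge0 ?addr_ge0 ?mulr_ge0 ?invr_ge0// ltW.
  lra.
rewrite ler_pdivlMr// => h; rewrite mulrAC ler_pdivlMr ?exprn_gt0//.
by apply: le_trans h; rewrite [leRHS]mulrAC -expr2 mulrC.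
Qed.

End Chain.

(** * Cutting at two sites, Green's formula and the eigenvalue bound *)

Section Eigen.
Variables (R : realType) (T : finType) (adj : rel T).
Hypotheses (adjC : symmetric adj) (adjxx : irreflexive adj).
Variable r : R.
Hypothesis r0 : 0 < r.
Implicit Types (A D : {set T}) (F f g : {set T} -> R).
Local Notation hsum := (hsum adj r).
Local Notation dirichlet := (dirichlet adj r).
Local Notation part_fun := (part_fun adj r).
Local Notation cvar := (cvar adj r).
Local Notation nbrs := (nbrs adj).

Lemma part_fun_sub A D : A \subset D -> part_fun A <= part_fun D.
Proof.
move=> AD; rewrite /part_fun /hsum [leRHS](bigID (fun B : {set T} => B \subset A)) /=.
rewrite [X in _ <= X + _]
  (eq_bigl (fun B : {set T} => (B \subset A) && indep adj B)) => [|B].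
  rewrite lerDl sumr_ge0// => B _; by rewrite mulr1 exprn_ge0// ltW.
rewrite andbAC; congr (_ && _); apply/andP/idP => [[]//|BA].
by split=> //; exact: subset_trans BA AD.
Qed.

Lemma dirichlet_ge0 A F : 0 <= dirichlet A F.
Proof.
apply: sumr_ge0 => x _; rewrite mulr_ge0 ?(ltW r0)//.
by apply: hsum_ge0 => // D _; rewrite sqr_ge0.
Qed.

(* The two cut sites c0 and c1 are negatively correlated, which makes up for
   the variance of the two conditional expectations. *)
Lemma two_cut_poincare A c0 c1 K : 0 <= K -> c0 \in A -> c1 \in A -> adj c0 c1 ->
  (forall c F, c \in [:: c0; c1] ->
     cvar (A :\ c) F <= K * dirichlet (A :\ c) F /\
     cvar (A :\ c :\: nbrs c) F <= K * dirichlet (A :\ c :\: nbrs c) F) ->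
  forall F, cvar A F <= 2 * (1 + r) * K * dirichlet A F.
Proof.
move=> K0 c0A c1A c01 H F.
have c10 : c1 != c0 by apply/eqP => e; move: c01; rewrite e adjxx.
have inner c : c \in A -> c \in [:: c0; c1] ->
    cvar (A :\ c) F + r * cvar (A :\ c :\: nbrs c) (occupy c F) <= K * dirichlet A F.
  move=> cA cc; rewrite (dirichlet_rec adjC adjxx _ F cA).
  have [h1 _] := H c F cc; have [_ h2] := H c (occupy c F) cc.
  have h3 := ler_wpM2l (ltW r0) h2.
  have : 0 <= K * (r * hsum (A :\ c :\: nbrs c) (fun D => (occupy c F D - F D) ^+ 2)).
    by rewrite mulr_ge0// mulr_ge0 ?(ltW r0)// hsum_ge0// => D _; rewrite sqr_ge0.
  lra.
have I0 := inner _ c0A (mem_head _ _).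
have I1 : cvar (A :\ c1) F + r * cvar (A :\ c1 :\: nbrs c1) (occupy c1 F)
    <= K * dirichlet A F by apply: inner => //; rewrite !inE eqxx orbT.
pose A00 := A :\ c0 :\ c1.
have E0 : A :\ c1 :\ c0 = A00 by apply/setP => z; rewrite !inE andbCA.
have E1 : A :\ c0 :\ c1 :\: nbrs c1 = A :\ c1 :\: nbrs c1.
  apply/setP => z; rewrite !inE; case: (z =P c0) => [->|]//=.
  by rewrite andbF adjC c01.
have E2 : A :\ c1 :\ c0 :\: nbrs c0 = A :\ c0 :\: nbrs c0.
  apply/setP => z; rewrite !inE; case: (z =P c1) => [->|]//=.
  by rewrite andbF c01.
have c1A0 : c1 \in A :\ c0 by rewrite !inE c10.
have c0A1 : c0 \in A :\ c1 by rewrite !inE eq_sym c10.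
have Z0 B : 0 < part_fun B by exact: part_fun_gt0.
have rec0 G : hsum (A :\ c0) G = hsum A00 G + r * hsum (A :\ c1 :\: nbrs c1) (occupy c1 G).
  by rewrite (hsum_rec adjC adjxx _ _ c1A0) E1.
have rec1 G : hsum (A :\ c1) G = hsum A00 G + r * hsum (A :\ c0 :\: nbrs c0) (occupy c0 G).
  by rewrite (hsum_rec adjC adjxx _ _ c0A1) E2 E0.
have rec G : hsum A G = hsum A00 G + r * hsum (A :\ c1 :\: nbrs c1) (occupy c1 G)
    + r * hsum (A :\ c0 :\: nbrs c0) (occupy c0 G).
  by rewrite (hsum_rec adjC adjxx _ _ c0A) rec0.
have sub0 : part_fun (A :\ c0 :\: nbrs c0) <= part_fun A00.
  apply: part_fun_sub; apply/subsetP => z; rewrite !inE => /and3P[zc z0 zA].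
  by rewrite z0 zA !andbT; apply: contraNneq zc => ->.
have sub1 : part_fun (A :\ c1 :\: nbrs c1) <= part_fun A00.
  apply: part_fun_sub; apply/subsetP => z; rewrite !inE => /and3P[zc z0 zA].
  by rewrite z0 zA !andbT; apply: contraNneq zc => ->; rewrite adjC.
have Q00 := hsum_sqr_ge adj r0 A00 F.
have Q0 := hsum_sqr_ge adj r0 (A :\ c0 :\: nbrs c0) (occupy c0 F).
have Q1 := hsum_sqr_ge adj r0 (A :\ c1 :\: nbrs c1) (occupy c1 F).
have recp0 : part_fun (A :\ c0) = part_fun A00 + r * part_fun (A :\ c1 :\: nbrs c1).
  exact: (rec0 (fun=> 1)).
have recp1 : part_fun (A :\ c1) = part_fun A00 + r * part_fun (A :\ c0 :\: nbrs c0).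
  exact: (rec1 (fun=> 1)).
have recp : part_fun A = part_fun A00 + r * part_fun (A :\ c1 :\: nbrs c1)
  + r * part_fun (A :\ c0 :\: nbrs c0) by exact: (rec (fun=> 1)).
move: I0 I1; rewrite /cvar recp recp0 recp1 !rec !rec0 !rec1.
have -> : hsum (A :\ c0 :\: nbrs c0) (occupy c0 (fun D => F D ^+ 2))
  = hsum (A :\ c0 :\: nbrs c0) (fun D => occupy c0 F D ^+ 2) by [].
have -> : hsum (A :\ c1 :\: nbrs c1) (occupy c1 (fun D => F D ^+ 2))
  = hsum (A :\ c1 :\: nbrs c1) (fun D => occupy c1 F D ^+ 2) by [].
move: (Z0 A00) (Z0 (A :\ c0 :\: nbrs c0)) (Z0 (A :\ c1 :\: nbrs c1)) sub0 sub1 Q00 Q0 Q1.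
move: (hsum A00 (fun D => F D ^+ 2)) (hsum A00 F) (part_fun A00)
  (hsum (A :\ c0 :\: nbrs c0) (fun D => occupy c0 F D ^+ 2))
  (hsum (A :\ c0 :\: nbrs c0) (occupy c0 F)) (part_fun (A :\ c0 :\: nbrs c0))
  (hsum (A :\ c1 :\: nbrs c1) (fun D => occupy c1 F D ^+ 2))
  (hsum (A :\ c1 :\: nbrs c1) (occupy c1 F)) (part_fun (A :\ c1 :\: nbrs c1))
  (dirichlet A F).
move=> q s z q0 s0 z0 q1 s1 z1 d zp z0p z1p le0 le1 h h0 h1 I0 I1.
have r0' := ltW r0; have zz1 : 0 < z + z1 by rewrite addr_gt0.
have zz0 : 0 < z + z0 by rewrite addr_gt0.
have zz : 0 < z + z1 + z0 by rewrite addr_gt0.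
have rz1 : 0 < z + r * z1 by rewrite addr_gt0// mulr_gt0.
have rz0 : 0 < z + r * z0 by rewrite addr_gt0// mulr_gt0.
have rz : 0 < z + r * z1 + r * z0 by rewrite addr_gt0// mulr_gt0.
(* The classes with neither cut site, only c0, or only c1 occupied have weights z, r z0, r z1. u and
   v compare the means of the last two classes with that of the first, and w collects the variances
   inside the classes. *)
pose u := s0 / z0 - s / z; pose v := s1 / z1 - s / z.
pose w := (q - s ^+ 2 / z) + r * (q0 - s0 ^+ 2 / z0) + r * (q1 - s1 ^+ 2 / z1).
have w0 : 0 <= w.
  apply: addr_ge0; first apply: addr_ge0; rewrite ?subr_ge0//.
    by rewrite mulr_ge0// subr_ge0.
  by rewrite mulr_ge0// subr_ge0.
have {}I0 : w + z * (r * z1) / (z + r * z1) * v ^+ 2 <= K * d.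
  apply: le_trans I0; rewrite le_eqVlt; apply/orP; left; apply/eqP.
  by rewrite /w /v; field; rewrite !gt_eqF.
have {}I1 : w + z * (r * z0) / (z + r * z0) * u ^+ 2 <= K * d.
  apply: le_trans I1; rewrite le_eqVlt; apply/orP; left; apply/eqP.
  by rewrite /w /u; field; rewrite !gt_eqF.
have -> : q + r * q1 + r * q0 - (s + r * s1 + r * s0) ^+ 2 / (z + r * z1 + r * z0)
  = w + (r * z0 * u ^+ 2 + r * z1 * v ^+ 2)
    - (r * z0 * u + r * z1 * v) ^+ 2 / (z + r * z1 + r * z0).
  by rewrite /w /u /v; field; rewrite !gt_eqF.
(* From z0 <= z follows z + r z0 <= (1 + r) z; this is the source of the factor 1 + r. *)
have B0 : r * z0 * u ^+ 2 <= (1 + r) * (z * (r * z0) / (z + r * z0) * u ^+ 2).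
  rewrite mulrA ler_wpM2r ?sqr_ge0// mulrA ler_pdivlMr//.
  have : r * z0 * (r * z0) <= r * z0 * (r * z).
    by rewrite ler_wpM2l ?ler_wpM2l// mulr_ge0// ltW.
  lra.
have B1 : r * z1 * v ^+ 2 <= (1 + r) * (z * (r * z1) / (z + r * z1) * v ^+ 2).
  rewrite mulrA ler_wpM2r ?sqr_ge0// mulrA ler_pdivlMr//.
  have : r * z1 * (r * z1) <= r * z1 * (r * z).
    by rewrite ler_wpM2l ?ler_wpM2l// mulr_ge0// ltW.
  lra.
have S0 : 0 <= (r * z0 * u + r * z1 * v) ^+ 2 / (z + r * z1 + r * z0).
  by rewrite divr_ge0 ?sqr_ge0// ltW.
have r1 : 0 <= 1 + r by rewrite addr_ge0.
have {}I0 := ler_wpM2l r1 I0; have {}I1 := ler_wpM2l r1 I1.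
have rw : 0 <= r * w by rewrite mulr_ge0.
lra.
Qed.

(** Detailed balance: particles leave at rate 1 and arrive at rate r, so the generator is symmetric
    for the weights r^|D|, and each pair D, x |: D contributes the product of the increments of f
    and g. *)
Lemma hsum_green A f g :
  hsum A (fun D => g D * (\sum_(x in D) (f D - f (D :\ x))
    + r * \sum_(x in A | (x \notin D) && indep adj (x |: D)) (f D - f (x |: D))))
  = \sum_(x in A) r * hsum (A :\ x :\: nbrs x)
      (fun D => (occupy x g D - g D) * (occupy x f D - f D)).
Proof.
pose G1 x (D : {set T}) := if x \in D then g D * (f D - f (D :\ x)) else 0.
pose G2 x (D : {set T}) := if (x \notin D) && indep adj (x |: D)
  then r * (g D * (f D - f (x |: D))) else 0.
transitivity (\sum_(x in A) (hsum A (G1 x) + hsum A (G2 x))).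
  rewrite big_split /= /hsum exchange_big /= [X in _ = _ + X]exchange_big /=.
  rewrite -big_split /=; apply: eq_bigr => D /andP[DA _].
  rewrite mulrDr mulrDr; congr (_ + _).
    rewrite -big_distrr /=; congr (_ * _); rewrite big_distrr /=.
    rewrite -big_mkcondr /=; apply: eq_bigl => x.
    by rewrite andb_idl// => /(subsetP DA).
  rewrite -big_distrr /=; congr (_ * _); rewrite !big_distrr /=.
  by rewrite -big_mkcondr /=; apply: eq_bigr => x _; rewrite mulrCA.
apply: eq_bigr => x xA.
have -> : hsum A (G1 x) = r * hsum (A :\ x :\: nbrs x)
    (fun D => occupy x g D * (occupy x f D - f D)).
  rewrite (hsum_rec adjC adjxx _ _ xA) (@eq_hsum _ _ _ _ (A :\ x) _ (fun=> 0)); last first.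
    by move=> D DA _; rewrite /G1 ifN//; move: DA; rewrite subsetD1 => /andP[].
  rewrite hsum_cst mul0r add0r; congr (_ * _); apply: eq_hsum => D DA _.
  rewrite /occupy /G1 setU11 setU1K//.
  by apply/negP => /(subsetP DA); rewrite !inE eqxx andbF.
have -> : hsum A (G2 x) = r * hsum (A :\ x :\: nbrs x)
    (fun D => g D * (f D - occupy x f D)).
  rewrite -hsumZ /hsum.
  rewrite [LHS](bigID (fun D : {set T} => (x \notin D) && indep adj (x |: D))) /=.
  rewrite [X in _ + X]big1 ?addr0 => [|D /andP[_ h]]; last by rewrite /G2 (negPf h) mulr0.
  apply: eq_big => D; last by move=> /andP[_ h]; rewrite /G2 h.
  rewrite -(subset_rem adjC adjxx _ xA) subUset sub1set xA /=.
  case: (D \subset A) => //=; case: (x \notin D); rewrite ?andbF//= andbT.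
  by rewrite andb_idl// (indepU1 adjC adjxx) => /andP[].
rewrite -mulrDr -hsumD; congr (_ * _); apply: eq_hsum => D _ _; ring.
Qed.

(** Green's formula with g = 1 shows that f has mean zero, since e is nonzero; with g = f it turns
    the Poincare inequality into a bound on e. *)
Lemma eigen_bound A K e kappa f : 0 < kappa -> e != 0 ->
  (forall F, cvar A F <= K * dirichlet A F) -> 0 <= K ->
  (forall D, D \subset A -> indep adj D ->
    e * f D = kappa * (\sum_(x in D) (f D - f (D :\ x))
      + r * \sum_(x in A | (x \notin D) && indep adj (x |: D)) (f D - f (x |: D)))) ->
  (exists D, [/\ D \subset A, indep adj D & f D != 0]) ->
  kappa <= K * e.
Proof.
move=> k0 e0 HK K0 fE [D0 [D0A D0i fD0]].
have green g : e * hsum A (fun D => g D * f D)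
    = kappa * \sum_(x in A) r * hsum (A :\ x :\: nbrs x)
      (fun D => (occupy x g D - g D) * (occupy x f D - f D)).
  rewrite -hsum_green -!hsumZ; apply: eq_hsum => D DA Di.
  by rewrite mulrCA fE// mulrCA.
have f_mean : hsum A f = 0.
  have := green (fun=> 1); rewrite big1 => [|x _]; last first.
    rewrite (@eq_hsum _ _ _ _ _ _ (fun=> 0)) ?hsum_cst ?mul0r ?mulr0//.
    by move=> D _ _; rewrite /occupy subrr mul0r.
  rewrite mulr0 => /eqP; rewrite mulf_eq0 (negPf e0) /= => /eqP <-.
  by apply: eq_hsum => D _ _; rewrite mul1r.
have f2 : e * hsum A (fun D => f D ^+ 2) = kappa * dirichlet A f.
  exact: (green f).
have f2p : 0 < hsum A (fun D => f D ^+ 2).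
  rewrite /hsum (bigD1 D0) ?D0A//= ltr_pwDl//.
    by apply: mulr_gt0; [exact: exprn_gt0 | rewrite lt0r sqrf_eq0 fD0 sqr_ge0].
  by apply: sumr_ge0 => D _; rewrite mulr_ge0 ?sqr_ge0// exprn_ge0// ltW.
have := HK f; rewrite /cvar f_mean expr0n /= mul0r subr0 => h.
suff : kappa * hsum A (fun D => f D ^+ 2) <= K * e * hsum A (fun D => f D ^+ 2).
  by rewrite ler_pM2r.
by apply: le_trans (ler_wpM2l (ltW k0) h) _; rewrite mulrCA -f2 mulrA.
Qed.

End Eigen.

(** * Hard-core gas on the ring *)

Section Ring.
Variable L : nat.
Implicit Types (x y c : 'I_L) (A D : {set 'I_L}).

Lemma val_iter_ordS k x : iter k (@ordS L) x = ((x + k) %% L)%N :> nat.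
Proof.
elim: k => [|k IH] /=; first by rewrite addn0 modn_small.
by rewrite IH -addn1 modnDml addn1 addnS.
Qed.

Lemma iter_ordS_eq j k x : (j <= k)%N ->
  (iter j (@ordS L) x == iter k (@ordS L) x) = (L %| k - j)%N.
Proof.
move=> jk; rewrite -val_eqE /= !val_iter_ordS -(subnKC jk) addKn addnA.
by rewrite -[X in X == _ %[mod _]]addn0 eqn_modDl mod0n eq_sym.
Qed.

Lemma iter_ordS_neq j k x : (j < k)%N -> (k - j < L)%N ->
  iter j (@ordS L) x != iter k (@ordS L) x.
Proof. by move=> jk kL; rewrite iter_ordS_eq ?(ltnW jk)// gtnNdvd// subn_gt0. Qed.

Definition adj3 : rel 'I_L :=
  fun x y => (y == iter 3 (@ordS L) x) || (x == iter 3 (@ordS L) y).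

Lemma adj3C : symmetric adj3.
Proof. by move=> x y; rewrite /adj3 orbC. Qed.

Lemma adj3xx : (3 < L)%N -> irreflexive adj3.
Proof.
by move=> L3 x; rewrite /adj3 orbb; apply/negbTE/(@iter_ordS_neq 0 3 x).
Qed.

Definition spaced A := forall x, x \in A ->
  (ordS x \notin A) && (ordS (ordS x) \notin A).

Lemma traject_iter k n x y :
  y \in traject (@ordS L) (iter k (@ordS L) x) n ->
  exists2 j, (k <= j < k + n)%N & y = iter j (@ordS L) x.
Proof.
move=> /trajectP[i iN ->]; exists (k + i)%N.
  by rewrite leq_addr ltn_add2l.
by rewrite addnC iterD.
Qed.

Lemma behead_filter (T : eqType) (P : pred T) (x : T) (s : seq T) :
  {subset behead (seq.filter P (x :: s)) <= s}.
Proof.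
rewrite /=; case: (P x) => /= y; first by rewrite mem_filter => /andP[].
by move/mem_behead; rewrite mem_filter => /andP[].
Qed.

(** By the spacing, only the next listed site can lie three steps ahead. As c belongs to A, every
    listed site is at least three steps after c, so no adjacency closes up across c. *)
Lemma chainlike_arc A D c k n : (6 < L)%N -> spaced A -> c \in A -> D \subset A ->
  (0 < k)%N -> (k + n <= L)%N ->
  chainlike adj3 (seq.filter (mem D) (traject (@ordS L) (iter k (@ordS L) c) n)).
Proof.
move=> L6 sA cA /subsetP DA; elim: n k => // n IH k k0 knL /=.
have IH1 := IH k.+1 (ltn0Sn k); rewrite addSnnS in IH1.
case: ifP => [/DA xA|_]; last by apply: IH1.
set x := iter k _ c; have [sx1 sx2] := andP (sA _ xA).
have {sx1}sx1 := contra (DA _) sx1; have {sx2}sx2 := contra (DA _) sx2.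
have k3 : (3 <= k)%N.
  have [c1 c2] := andP (sA _ cA).
  case: (k) k0 xA => [|[|[|]]]// _ /= h; first by rewrite h in c1.
  by rewrite h in c2.
apply/and3P; split; last by apply: IH1.
  rewrite mem_filter negb_and; apply/orP; right; apply/negP => xT.
  have [j /andP[kj jn] xE] := @traject_iter k.+1 n c x xT.
  move: (@iter_ordS_neq k j c kj); rewrite -xE eqxx => /(_ _)/negP; apply=> //.
  by apply: leq_ltn_trans (leq_subr _ _) _; lia.
apply/allP => y yb.
have [j /andP[kj jn] ->] : exists2 j, (k + 4 <= j < k + n.+1)%N & y = iter j (@ordS L) c.
  move: yb; rewrite -[ordS x]/(iter k.+1 (@ordS L) c).
  case: n {IH IH1} knL => [|[|[|n]]] knL; rewrite //= ?(negPf sx1) ?(negPf sx2)//=.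
  move=> /behead_filter h; have [j jn ->] := @traject_iter (4 + k) n c y h.
  exists j => //; lia.
rewrite /adj3 negb_or -!iterD; apply/andP; split.
  by rewrite eq_sym; apply: iter_ordS_neq; lia.
rewrite iter_ordS_eq; last by lia.
apply/negP => /dvdnP[q qE]; have : (q < 2)%N by nia.
case: q qE => [|[|]]//; lia.
Qed.

Lemma arc_sset A c : c \notin A -> (0 < L)%N ->
  sset (seq.filter (mem A) (traject (@ordS L) (ordS c) L.-1)) = A.
Proof.
move=> cA L0; apply/setP => x; rewrite inE mem_filter andb_idr// => xA.
apply/trajectP; pose d := (x + L - c)%N.
have cL := ltn_ord c; have xL := ltn_ord x.
have xE : x = iter (d %% L) (@ordS L) c.
  apply: val_inj; rewrite /= val_iter_ordS modnDmr /d.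
  by rewrite subnKC ?modnDr ?modn_small//; lia.
have d0 : (0 < d %% L)%N.
  rewrite lt0n; apply: contraNneq cA => d0; rewrite d0 /= in xE.
  by rewrite -xE.
exists (d %% L).-1; first by have := ltn_pmod d L0; lia.
by rewrite {1}xE -[in LHS](prednK d0) iterSr.
Qed.

Variables (R : realType) (r theta : R).
Hypotheses (r0 : 0 < r) (th0 : 0 < theta) (th1 : theta < 1).
Hypothesis f_le : forall n, (4 <= n)%N -> 3 * f_term n r <= theta ^+ 2.

Lemma chainlike_free s : uniq s -> {in s &, forall x y, ~~ adj3 x y} ->
  chainlike adj3 s.
Proof.
elim: s => // x s IH /= /andP[xs us] h; apply/and3P; split=> //.
  by apply/allP => y /mem_behead ys; apply: h; rewrite !inE ?eqxx ?ys ?orbT.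
by apply: IH => // y z ys zs; apply: h; rewrite !inE ?ys ?zs orbT.
Qed.

Lemma ring_poincare A F : (6 < L)%N -> spaced A ->
  cvar adj3 r A F <= 6 * (1 + 2 * r) / (1 - theta) ^+ 2 * dirichlet adj3 r A F.
Proof.
move=> L6 sA; have adjxx := adj3xx (ltn_trans (isT : 3 < 6)%N L6).
have adjC := adj3C.
have d0 : 0 < (1 - theta) ^+ 2 by rewrite exprn_gt0// subr_gt0.
have K0 : 0 <= 2 / (1 - theta) ^+ 2 by rewrite divr_ge0// ltW.
have dir0 := dirichlet_ge0 adj3 r0 A F.
have chain s G := @chain_poincare R _ adj3 adjC adjxx r r0 theta th0 th1 f_le s G.
have [/existsP[c0 /existsP[c1 /and3P[c0A c1A c01]]]|none]
  := boolP [exists c0, exists c1, [&& c0 \in A, c1 \in A & adj3 c0 c1]].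
  apply: le_trans (_ : _ <= 2 * (1 + r) * (2 / (1 - theta) ^+ 2) * dirichlet adj3 r A F) _.
    apply: (two_cut_poincare adjC adjxx r0 K0 c0A c1A c01) => c G cc.
    have cA : c \in A by move: cc; rewrite !inE => /orP[]/eqP->.
    have cut D : D \subset A :\ c -> cvar adj3 r D G
        <= 2 / (1 - theta) ^+ 2 * dirichlet adj3 r D G.
      rewrite subsetD1 => /andP[DA cD].
      rewrite -(arc_sset cD (ltn_trans (isT : 0 < 6)%N L6)); apply: chain.
      by apply: (@chainlike_arc A D c 1) => //; rewrite add1n prednK// (ltn_trans _ L6).
    by split; apply: cut => //; exact: subsetDl.
  (* The two cuts give 4 (1 + r), which is at most the constant 6 (1 + 2 r) of the gap bound. *)
  have le46 : 2 * (1 + r) * 2 <= 6 * (1 + 2 * r) by have := r0; lra.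
  by rewrite ler_wpM2r// mulrA ler_wpM2r ?invr_ge0 ?(ltW d0).
(* Without adjacent sites in A any enumeration of A is chainlike. *)
have -> : A = sset (enum A) by apply/setP => x; rewrite inE mem_enum.
apply: le_trans (chain _ _ _) _.
  apply: chainlike_free; first exact: enum_uniq.
  move=> x y; rewrite !mem_enum => xA yA; apply: contraNN none => xy.
  by apply/existsP; exists x; apply/existsP; exists y; rewrite xA yA.
rewrite ler_wpM2r ?dirichlet_ge0// ler_wpM2r ?invr_ge0 ?(ltW d0)//.
by have := r0; lra.
Qed.

End Ring.

(** * Tilings *)

Ltac bool_cases :=
  repeat (match goal with |- context [?x \in ?A] => case: (x \in A) => //= end).

Section Tilings.
Variable L : nat.
Hypothesis L20 : (20 < L)%N.
Implicit Types (x y : 'I_L) (X D rho : {set 'I_L}).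

Local Notation S1 := (@ordS L).
Local Notation P1 := (@ord_pred L).

(* A dimer at x replaces the pattern 1001 of the root configuration rho on the
   sites x - 1, .., x + 2 by 0110. *)
Definition dimer_sites rho : {set 'I_L} :=
  [set x | (P1 x \in rho) && (S1 (S1 x) \in rho)].

Definition tiling rho D : {set 'I_L} :=
  [set y | [|| y \in D, P1 y \in D |
            [&& y \in rho, S1 y \notin D & P1 (P1 y) \notin D]]].

(** On a window 1001 or 0110 this is the hop or its inverse. As a symmetric difference it is an
    involution of all configurations, by which sums can be reindexed. *)
Definition toggle x X : {set 'I_L} :=
  [set y | (y \in X) (+) (y \in [:: P1 x; x; S1 x; S1 (S1 x)])].

(* Writing all sites of a window as iterates of ordS on its leftmost site turns
   the local statements below into propositional ones. *)
Lemma from_left k x : {y | x = iter k S1 y}.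
Proof.
by exists (iter k P1 x); elim: k => // k IH; rewrite iterSr [iter k.+1 P1 x]iterS ord_predK.
Qed.

Lemma iter_eqE x j k : (j < L)%N -> (k < L)%N ->
  (iter j S1 x == iter k S1 x) = (j == k).
Proof.
move=> jL kL; have [->|jk] := eqVneq j k; first by rewrite eqxx.
apply/negbTE; move: jk; rewrite neq_ltn => /orP[] h; last rewrite eq_sym.
  by apply: iter_ordS_neq h _; apply: leq_ltn_trans (leq_subr _ _) _.
by apply: iter_ordS_neq h _; apply: leq_ltn_trans (leq_subr _ _) _.
Qed.

Variables (rho D : {set 'I_L}).
Hypotheses (srho : spaced rho) (DB : D \subset dimer_sites rho)
  (Di : indep (@adj3 L) D).

Lemma dimer_rho y : (S1 y \in D) ==> (y \in rho) && (S1 (S1 (S1 y)) \in rho).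
Proof.
by apply/implyP => /(subsetP DB); rewrite inE ordSK.
Qed.

Lemma rho_spaced y : (y \in rho) ==> (S1 y \notin rho) && (S1 (S1 y) \notin rho).
Proof. by apply/implyP/srho. Qed.

Lemma dimer_indep y : ~~ ((y \in D) && (S1 (S1 (S1 y)) \in D)).
Proof.
apply/negP => /andP[yD zD]; move/indepP: Di => /(_ _ _ yD zD).
by rewrite /adj3 /= eqxx.
Qed.

Ltac facts b k :=
  match k with
  | O => idtac
  | S ?k' => move: (rho_spaced (iter k' S1 b)) (dimer_rho (iter k' S1 b))
               (dimer_indep (iter k' S1 b)); facts b k'
  end.

Lemma tiling_dimer x : (x \in tiling rho D) && (S1 x \in tiling rho D) = (x \in D).
Proof.
have [b ->] := from_left 4 x; rewrite /= !inE !ordSK.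
facts b 8%N => /=; bool_cases.
Qed.

Lemma tiling_next2 x : ~~ ((x \in tiling rho D) && (S1 (S1 x) \in tiling rho D)).
Proof.
have [b ->] := from_left 4 x; rewrite /= !inE !ordSK.
facts b 9%N => /=; bool_cases.
Qed.

Lemma indep_addE x :
  indep (@adj3 L) (x |: D) = (iter 3 S1 x \notin D) && (iter 3 P1 x \notin D).
Proof.
have L3 : (3 < L)%N by apply: leq_trans L20.
rewrite (indepU1 (@adj3C L) (adj3xx L3)) Di /=.
apply/pred0P/andP => [h|[h1 h2] y].
  split; apply/negP => yD; [move: (h (iter 3 S1 x))|move: (h (iter 3 P1 x))].
    by rewrite /= inE yD /adj3 eqxx.
  by rewrite /= inE yD /adj3 /= !ord_predK eqxx orbT.
apply/negbTE; rewrite /= inE; apply/negP => /andP[yD /orP[]/eqP yE].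
  by rewrite yE in yD; rewrite yD in h1.
by rewrite yE /= !ordSK yD in h2.
Qed.

(** With [tiling_dimer] and [tiling_next2] this decides which terms of the Hamiltonian act on a
    tiling: each of them adds or removes one dimer of the same root. *)
Lemma tiling_pair x : (P1 x \in tiling rho D) && (S1 (S1 x) \in tiling rho D)
  = [&& x \in dimer_sites rho, x \notin D & indep (@adj3 L) (x |: D)].
Proof.
rewrite indep_addE; have [b ->] := from_left 6 x; rewrite /= !inE !ordSK.
facts b 12%N => /=; bool_cases.
Qed.

Lemma tiling_rem x : x \in D -> tiling rho (D :\ x) = toggle x (tiling rho D).
Proof.
move=> xD; apply/setP => y; rewrite !inE.
(* Deleting x from D affects the tests in [tiling] only when y is one of the four toggled sites. *)
have -> : (S1 y == x) = (y == P1 x) by rewrite -(inj_eq (@ord_pred_inj L)) ordSK.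
have -> : (P1 y == x) = (y == S1 x) by rewrite -(inj_eq (@ordS_inj L)) ord_predK.
have -> : (P1 (P1 y) == x) = (y == S1 (S1 x)).
  by rewrite -(inj_eq (@ordS_inj L)) -(inj_eq (@ordS_inj L)) !ord_predK.
have d j k : (j < 9)%N -> (k < 9)%N ->
    forall b, (iter j S1 b == iter k S1 b) = (j == k).
  move=> j9 k9 b; have lt m : (m < 9)%N -> (m < L)%N.
    by move=> m9; exact: leq_trans (leq_trans m9 (isT : 9 <= 20)%N) (ltnW L20).
  by apply: iter_eqE; apply: lt.
have [yE|y1] := eqVneq y (P1 x).
  rewrite {}yE; move: xD; have [b ->] := from_left 5 x; rewrite /= !ordSK => xD.
  rewrite (d 4 5)%N// (d 4 6)%N// (d 4 7)%N//.
  move: xD; facts b 9%N => /=; bool_cases.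
have [yE|y2] := eqVneq y x.
  rewrite {}yE; move: xD; have [b ->] := from_left 5 x; rewrite /= !ordSK => xD.
  rewrite (d 5 6)%N// (d 5 7)%N//.
  move: xD; facts b 9%N => /=; bool_cases.
have [yE|y3] := eqVneq y (S1 x).
  rewrite {}yE; move: xD; have [b ->] := from_left 5 x; rewrite /= !ordSK => xD.
  rewrite (d 6 7)%N//.
  move: xD; facts b 10%N => /=; bool_cases.
have [yE|y4] := eqVneq y (S1 (S1 x)).
  rewrite {}yE; move: xD; have [b ->] := from_left 5 x; rewrite /= !ordSK => xD.
  move: xD; facts b 11%N => /=; bool_cases.
by rewrite addbF.
Qed.

Lemma toggleK x : involutive (toggle x).
Proof. by move=> X; apply/setP => y; rewrite !inE addbK. Qed.

End Tilings.

(** * Recognising tilings by excluded patterns *)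

Section TilingOfConfiguration.
Variable L : nat.
Hypothesis L20 : (20 < L)%N.
Local Notation S1 := (@ordS L).
Local Notation P1 := (@ord_pred L).
Implicit Types (x y : 'I_L) (X D rho : {set 'I_L}).

Lemma tiling_add rho D x : spaced rho -> D \subset dimer_sites rho ->
  indep (@adj3 L) D -> [&& x \in dimer_sites rho, x \notin D & indep (@adj3 L) (x |: D)] ->
  tiling rho (x |: D) = toggle x (tiling rho D).
Proof.
move=> srho DB Di /and3P[xB xD xDi].
rewrite -{2}(setU1K xD) (tiling_rem L20 srho _ xDi) ?setU11 ?toggleK//.
by rewrite subUset sub1set xB.
Qed.

(* The excluded patterns are 1*1, 11**1, 1**11 and 11***11. *)
Definition no_bad_pattern X := forall y,
  [&& ~~ ((y \in X) && (iter 2 S1 y \in X)),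
      ~~ [&& y \in X, iter 1 S1 y \in X & iter 4 S1 y \in X],
      ~~ [&& y \in X, iter 3 S1 y \in X & iter 4 S1 y \in X] &
      ~~ [&& y \in X, iter 1 S1 y \in X, iter 5 S1 y \in X & iter 6 S1 y \in X]].

(** The dimers are the occupied neighbouring pairs, and spreading all of them recovers the root.
    Without the excluded patterns the root particles so obtained are at mutual distance at least
    three. *)
Lemma tilingP X : no_bad_pattern X -> exists rho D,
  [/\ spaced rho, D \subset dimer_sites rho, indep (@adj3 L) D & X = tiling rho D].
Proof.
move=> hX; pose D := [set x | (x \in X) && (S1 x \in X)].
pose rho := [set y | [|| S1 y \in D, P1 (P1 y) \in D |
  [&& y \in X, S1 y \notin X & P1 y \notin X]]].
exists rho, D; split.
- move=> x; have [b ->] := from_left 5 x; rewrite /= !inE !ordSK.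
  move: (hX (iter 0 S1 b)) (hX (iter 1 S1 b)) (hX (iter 2 S1 b)) (hX (iter 3 S1 b))
    (hX (iter 4 S1 b)) (hX (iter 5 S1 b)) (hX (iter 6 S1 b)) => /=; bool_cases.
- apply/subsetP => x; have [b ->] := from_left 5 x; rewrite /= !inE !ordSK.
  move: (hX (iter 0 S1 b)) (hX (iter 1 S1 b)) (hX (iter 2 S1 b)) (hX (iter 3 S1 b))
    (hX (iter 4 S1 b)) (hX (iter 5 S1 b)) (hX (iter 6 S1 b)) => /=; bool_cases.
- have h x : x \in D -> iter 3 S1 x \notin D.
    by rewrite !inE; move: (hX (S1 x)) => /=; bool_cases.
  apply/indepP => x y xD yD; rewrite negb_or; apply/andP; split; apply/eqP => e.
    by rewrite e (negPf (h x xD)) in yD.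
  by rewrite e (negPf (h y yD)) in xD.
apply/setP => x; have [b ->] := from_left 5 x; rewrite /= !inE !ordSK.
move: (hX (iter 0 S1 b)) (hX (iter 1 S1 b)) (hX (iter 2 S1 b)) (hX (iter 3 S1 b))
    (hX (iter 4 S1 b)) (hX (iter 5 S1 b)) (hX (iter 6 S1 b)) => /=; bool_cases.
Qed.

End TilingOfConfiguration.

Local Open Scope complex_scope.

(** * Matrix elements of the Hamiltonian *)

Section Amplitudes.
Variables (R : realType) (L : nat).
Implicit Types (x : 'I_L) (X : {set 'I_L}) (psi phi : 'cV[R[i]]_#|{: config L}|).

Definition occupation X : config L := [ffun y => if y \in X then 1 else 0].

Lemma occupation_bij : bijective occupation.
Proof.
exists (fun s : config L => [set y | s y == 1]) => [X|s].
  by apply/setP => y; rewrite inE ffunE; case: (y \in X).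
by apply/ffunP => y; rewrite ffunE inE; case: (s y) => -[|[|m]] //= h; apply: val_inj.
Qed.

Definition amp psi X : R[i] := psi (enum_rank (occupation X)) 0.

Definition replace (s : config L) x (j : 'I_2) : config L :=
  [ffun y => if y == x then j else s y].

Lemma site_op_delta (i j : 'I_2) x (s t : config L) :
  site_op (delta_mx i j : 'M[R[i]]_2) x (enum_rank s) (enum_rank t)
  = ((s x == i) && (t == replace s x j))%:R.
Proof.
rewrite /site_op /tensor_op mxE /config_of !enum_rankK.
have [/andP[/eqP sx /eqP ->]|] := boolP ((s x == i) && (t == replace s x j)).
  rewrite big1// => y _; rewrite ffunE; case: eqP => [->|_].
    by rewrite mxE sx !eqxx.
  by rewrite mxE eqxx.
rewrite negb_and => /orP[sx|tx]; apply/eqP; rewrite prodf_seq_eq0; apply/hasP.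
  by exists x; rewrite ?mem_index_enum//= eqxx mxE (negPf sx).
have [y ty] : exists y, t y != replace s x j y.
  apply/existsP; apply: contraNT tx => /existsPn h.
  by apply/eqP/ffunP => y; apply/eqP/negPn/h.
exists y; rewrite ?mem_index_enum//=; move: ty; rewrite ffunE.
case: (eqVneq y x) => [->|yx] ty; first by rewrite /= mxE (negPf ty) andbF.
by rewrite /= mxE [s y == _]eq_sym (negPf ty).
Qed.

Lemma amp_delta (i j : 'I_2) x psi X :
  amp (site_op (delta_mx i j) x *m psi) X
  = (occupation X x == i)%:R * psi (enum_rank (replace (occupation X) x j)) 0.
Proof.
rewrite /amp mxE (reindex (@enum_rank (config L))) /=; last first.
  by apply: onW_bij; exact: enum_rank_bij.
rewrite (bigD1 (replace (occupation X) x j)) //= site_op_delta eqxx andbT.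
rewrite big1 ?addr0// => t /negPf tx.
by rewrite site_op_delta tx andbF mul0r.
Qed.

Lemma occupation1 X x : (occupation X x == 1) = (x \in X).
Proof. by rewrite ffunE; case: (x \in X). Qed.

Lemma occupation0 X x : (occupation X x == 0) = (x \notin X).
Proof. by rewrite ffunE; case: (x \in X). Qed.

Lemma replace1 X x : replace (occupation X) x 1 = occupation (x |: X).
Proof. by apply/ffunP => y; rewrite !ffunE !inE; case: eqP. Qed.

Lemma replace0 X x : replace (occupation X) x 0 = occupation (X :\ x).
Proof. by apply/ffunP => y; rewrite !ffunE !inE; case: eqP. Qed.

Lemma adjoint_delta n (i j : 'I_n) : adjoint (delta_mx i j : 'M[R[i]]_n) = delta_mx j i.
Proof. by rewrite /adjoint trmx_delta map_delta_mx. Qed.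

Lemma number_opE : number_op R = delta_mx 1 1.
Proof. by rewrite /number_op /sigma_plus adjoint_delta mul_delta_mx. Qed.

Lemma amp_minus x psi X : amp (site_op (sigma_minus R) x *m psi) X
  = if x \in X then 0 else amp psi (x |: X).
Proof.
by rewrite amp_delta occupation0 replace1 -if_neg; case: ifP; rewrite ?mul1r ?mul0r.
Qed.

Lemma amp_plus x psi X : amp (site_op (sigma_plus R) x *m psi) X
  = if x \in X then amp psi (X :\ x) else 0.
Proof.
rewrite /sigma_plus adjoint_delta amp_delta occupation1 replace0.
by case: ifP; rewrite ?mul1r ?mul0r.
Qed.

Lemma amp_number x psi X : amp (site_op (number_op R) x *m psi) X
  = if x \in X then amp psi X else 0.
Proof.
rewrite number_opE amp_delta occupation1 replace1; case: ifP => xX; rewrite ?mul1r ?mul0r//.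
by rewrite /amp (setUidPr _)// sub1set.
Qed.

Lemma ampD psi phi X : amp (psi + phi) X = amp psi X + amp phi X.
Proof. by rewrite /amp mxE. Qed.

Lemma ampN psi X : amp (- psi) X = - amp psi X.
Proof. by rewrite /amp mxE. Qed.

Lemma ampZ a psi X : amp (a *: psi) X = a * amp psi X.
Proof. by rewrite /amp mxE. Qed.

Lemma amp_sum (I : Type) (s : seq I) (F : I -> 'cV[R[i]]_#|{: config L}|) X :
  amp (\sum_(i <- s) F i) X = \sum_(i <- s) amp (F i) X.
Proof. by rewrite /amp summxE. Qed.

Lemma sum_amp (F : R[i] -> R[i] -> R[i]) psi phi :
  \sum_k F (psi k 0) (phi k 0) = \sum_X F (amp psi X) (amp phi X).
Proof.
rewrite (reindex (@enum_rank (config L))) /=; last first.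
  by apply: onW_bij; exact: enum_rank_bij.
by rewrite (reindex occupation)//; apply: onW_bij; exact: occupation_bij.
Qed.

Lemma adjointM n (A B : 'M[R[i]]_n) : adjoint (A *m B) = adjoint B *m adjoint A.
Proof. by rewrite /adjoint trmx_mul map_mxM. Qed.

Lemma adjointD n (A B : 'M[R[i]]_n) : adjoint (A + B) = adjoint A + adjoint B.
Proof. by apply/matrixP => i j; rewrite !mxE rmorphD. Qed.

Lemma adjointN n (A : 'M[R[i]]_n) : adjoint (- A) = - adjoint A.
Proof. by apply/matrixP => i j; rewrite !mxE rmorphN. Qed.

Lemma adjointZ n a (A : 'M[R[i]]_n) : adjoint (a *: A) = a^* *: adjoint A.
Proof. by apply/matrixP => i j; rewrite !mxE rmorphM. Qed.

Lemma adjoint_site_op (A : 'M[R[i]]_2) x : adjoint (site_op A x) = site_op (adjoint A) x.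
Proof.
apply/matrixP => s t; rewrite !mxE rmorph_prod; apply: eq_bigr => y _.
case: eqP => _; rewrite !mxE//.
by rewrite eq_sym rmorph_nat.
Qed.

End Amplitudes.

(** * The action of q_x and its adjoint on amplitudes *)

Section Action.
Variables (R : realType) (L : nat).
Hypothesis L20 : (20 < L)%N.
Variables (lambda : R[i]) (kappa : R).
Implicit Types (x : 'I_L) (X : {set 'I_L}) (psi phi : 'cV[R[i]]_#|{: config L}|).
Local Notation S1 := (@ordS L).
Local Notation P1 := (@ord_pred L).

Lemma right_eigenvalueP n (A : 'M[R[i]]_n) a :
  reflect (exists2 v : 'cV_n, A *m v = a *: v & v != 0) (eigenvalue A a).
Proof.
have -> : eigenvalue A a = eigenvalue A^T a.
  rewrite !eigenvalue_root_char /char_poly -det_tr /char_poly_mx linearB /=.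
  by rewrite tr_scalar_mx map_trmx.
apply: (iffP eigenvalueP) => -[v vA v0].
  exists v^T; last by rewrite -(inj_eq (@trmx_inj _ _ _)) trmxK trmx0.
  by apply: trmx_inj; rewrite trmx_mul trmxK vA linearZ /= trmxK.
exists v^T; last by rewrite -(inj_eq (@trmx_inj _ _ _)) trmxK trmx0.
by rewrite -trmx_mul vA linearZ.
Qed.

Lemma amp_eq0 psi : (forall X, amp psi X = 0) -> psi = 0.
Proof.
move=> h; apply/colP => k; have [g gK Kg] := occupation_bij L.
by have := h (g (enum_val k)); rewrite /amp Kg enum_valK mxE.
Qed.

Lemma ordS_neqs x : [/\ S1 x != x, S1 (S1 x) != P1 x & [/\ S1 (S1 x) != x,
  P1 x != x, P1 x != S1 x & S1 (S1 x) != S1 x]].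
Proof.
have [b ->] := from_left 1 x; rewrite /= ordSK.
have l k : (k < 9)%N -> (k < L)%N.
  by move=> m9; exact: leq_trans (leq_trans m9 (isT : 9 <= 20)%N) (ltnW L20).
have d j k : (j < 9)%N -> (k < 9)%N -> j != k -> iter j S1 b != iter k S1 b.
  by move=> /l jL /l kL jk; rewrite iter_eqE.
by split; [exact: (d 2 1)%N|exact: (d 3 0)%N|split; [exact: (d 3 1)%N|
  exact: (d 0 1)%N|exact: (d 0 2)%N|exact: (d 3 2)%N]].
Qed.

Lemma amp_q x psi X : amp (q_op lambda x *m psi) X =
  (if (x \in X) || (S1 x \in X) then 0 else amp psi (S1 x |: (x |: X)))
  - lambda * (if (P1 x \in X) || (S1 (S1 x) \in X) then 0
              else amp psi (S1 (S1 x) |: (P1 x |: X))).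
Proof.
have [n1 n2 _] := ordS_neqs x.
rewrite /q_op mulmxBl -scalemxAl -!mulmxA ampD ampN ampZ !amp_minus !inE.
by rewrite (negPf n1) (negPf n2) /=; do 4?case: ifP => //= _.
Qed.

Lemma amp_q_adj x psi X : amp (adjoint (q_op lambda x) *m psi) X =
  (if (x \in X) && (S1 x \in X) then amp psi (X :\ S1 x :\ x) else 0)
  - lambda^* * (if (P1 x \in X) && (S1 (S1 x) \in X)
                then amp psi (X :\ S1 (S1 x) :\ P1 x) else 0).
Proof.
have [n1 n2 _] := ordS_neqs x.
rewrite /q_op adjointD adjointN adjointZ !adjointM !adjoint_site_op.
rewrite -/(sigma_plus R) mulmxBl -scalemxAl -!mulmxA ampD ampN ampZ !amp_plus !inE.
rewrite [x == _]eq_sym [P1 x == _]eq_sym (negPf n1) (negPf n2) /=.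
by case: (x \in X); case: (S1 x \in X); case: (P1 x \in X); case: (S1 (S1 x) \in X).
Qed.

Definition dimer_at x X :=
  [&& x \in X, S1 x \in X, P1 x \notin X & S1 (S1 x) \notin X].

Definition spread_at x X :=
  [&& P1 x \in X, S1 (S1 x) \in X, x \notin X & S1 x \notin X].

Lemma in_toggle x X z : (z \in toggle x X) =
  (z \in X) (+) [|| z == P1 x, z == x, z == S1 x | z == S1 (S1 x)].
Proof. by rewrite !inE. Qed.

(** q_x empties the pair x, x + 1 or the pair x - 1, x + 2 and its adjoint refills either one, so
    only X and the toggled X enter. *)
Lemma amp_qq_dimer x psi X : dimer_at x X ->
  amp (adjoint (q_op lambda x) *m (q_op lambda x *m psi)) X
  = amp psi X - lambda * amp psi (toggle x X).
Proof.
have [n1 n2 [n3 n4 n5 n6]] := ordS_neqs x.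
move=> /and4P[x0 x1 xp x2].
rewrite amp_q_adj x0 x1 (negPf xp) /= mulr0 subr0 amp_q !inE !eqxx /= andbF.
rewrite (negPf xp) (negPf x2) !andbF /=.
have -> : S1 x |: (x |: X :\ S1 x :\ x) = X.
  apply/setP => z; rewrite !inE; case: (eqVneq z (S1 x)) => [->|]//=.
  by case: (eqVneq z x) => [->|].
suff -> : S1 (S1 x) |: (P1 x |: X :\ S1 x :\ x) = toggle x X by [].
apply/setP => z; rewrite in_toggle !inE.
case: (eqVneq z (S1 (S1 x))) => [->|_]; first by rewrite (negPf x2) !orbT.
case: (eqVneq z (P1 x)) => [->|_]; first by rewrite (negPf xp).
case: (eqVneq z (S1 x)) => [->|_]; first by rewrite x1 !orbT andbF.
by case: (eqVneq z x) => [->|_]; rewrite ?x0 //= addbF.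
Qed.

Lemma amp_qq_spread x psi X : spread_at x X ->
  amp (adjoint (q_op lambda x) *m (q_op lambda x *m psi)) X
  = lambda^* * (lambda * amp psi X - amp psi (toggle x X)).
Proof.
have [n1 n2 [n3 n4 n5 n6]] := ordS_neqs x.
move=> /and4P[xp x2 x0 x1].
rewrite amp_q_adj xp x2 (negPf x0) /= sub0r amp_q !inE !eqxx /= andbF.
rewrite (negPf x0) (negPf x1) !andbF /= -mulrN opprB.
have -> : S1 (S1 x) |: (P1 x |: X :\ S1 (S1 x) :\ P1 x) = X.
  apply/setP => z; rewrite !inE; case: (eqVneq z (S1 (S1 x))) => [->|]//=.
  by case: (eqVneq z (P1 x)) => [->|].
suff -> : S1 x |: (x |: X :\ S1 (S1 x) :\ P1 x) = toggle x X by [].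
apply/setP => z; rewrite in_toggle !inE.
case: (eqVneq z (S1 x)) => [->|_]; first by rewrite (negPf x1) !orbT.
case: (eqVneq z x) => [->|_]; first by rewrite (negPf x0) !orbT.
case: (eqVneq z (P1 x)) => [->|_]; first by rewrite xp.
by case: (eqVneq z (S1 (S1 x))) => [->|_]; rewrite ?x2 //= addbF.
Qed.

Lemma amp_qq_idle x psi X : ~~ ((x \in X) && (S1 x \in X)) ->
  ~~ ((P1 x \in X) && (S1 (S1 x) \in X)) ->
  amp (adjoint (q_op lambda x) *m (q_op lambda x *m psi)) X = 0.
Proof. by move=> /negPf h1 /negPf h2; rewrite amp_q_adj h1 h2 mulr0 subrr. Qed.

End Action.

(** * Eigenvectors on tilings *)

Section Spectrum.
Variables (R : realType) (L : nat).
Hypothesis L20 : (20 < L)%N.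
Variables (lambda : R[i]) (kappa : R).
Hypotheses (lambda_neq0 : lambda != 0) (kappa_gt0 : 0 < kappa).
Implicit Types (x : 'I_L) (X D rho : {set 'I_L}) (psi phi : 'cV[R[i]]_#|{: config L}|).
Local Notation S1 := (@ordS L).
Local Notation P1 := (@ord_pred L).
Local Notation r := (Normc.normc lambda ^+ 2).

Lemma amp_H psi X : amp (H_per lambda kappa L *m psi) X =
  \sum_x ((if (x \in X) && (S1 (S1 x) \in X) then amp psi X else 0)
    + kappa%:C * amp (adjoint (q_op lambda x) *m (q_op lambda x *m psi)) X).
Proof.
rewrite /H_per mulmx_suml amp_sum; apply: eq_bigr => x _.
rewrite mulmxDl ampD -scalemxAl ampZ -!mulmxA !amp_number.
by case: (x \in X); case: (S1 (S1 x) \in X).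
Qed.

Lemma conj_mul_lambda : lambda^* * lambda = r%:C.
Proof. by rewrite mulrC -sqr_normc rmorphXn. Qed.

Lemma r_gt0 : 0 < r.
Proof.
rewrite lt0r sqrf_eq0 sqr_ge0 andbT; apply: contra_neq lambda_neq0.
exact: Normc.eq0_normc.
Qed.

Lemma amp_H_tiling psi rho D : spaced rho -> D \subset dimer_sites rho ->
  indep (@adj3 L) D ->
  amp (H_per lambda kappa L *m psi) (tiling rho D) = kappa%:C *
   (\sum_(x in D) (amp psi (tiling rho D) - lambda * amp psi (tiling rho (D :\ x)))
   + \sum_(x in dimer_sites rho | (x \notin D) && indep (@adj3 L) (x |: D))
      lambda^* * (lambda * amp psi (tiling rho D) - amp psi (tiling rho (x |: D)))).
Proof.
move=> srho DB Di; rewrite amp_H.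
have dE x := tiling_dimer srho DB Di x.
have nn x := tiling_next2 srho DB Di x.
have pE x := tiling_pair L20 srho DB Di x.
set X := tiling rho D in dE nn pE *.
rewrite mulrDr !big_distrr /= [X in _ = X + _]big_mkcond /= [X in _ = _ + X]big_mkcond /=.
rewrite -big_split /=; apply: eq_bigr => x _.
rewrite (negPf (nn x)) add0r -pE -dE.
move: (nn x) (nn (P1 x)) (dE x) (pE x); rewrite ord_predK.
have [/andP[x0 x1]|h0] := boolP ((x \in X) && (S1 x \in X)).
  rewrite x0 x1 /= => x2 xp xD _; rewrite andbT in xp.
  rewrite (negPf x2) andbF addr0 (tiling_rem L20 srho DB Di) -?xD//.
  by rewrite amp_qq_dimer// /dimer_at x0 x1 x2 xp.
have [/andP[xp x2]|h1] := boolP ((P1 x \in X) && (S1 (S1 x) \in X)).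
  rewrite x2 xp !andbT /= => x0 x1 xD xadd.
  rewrite add0r (tiling_add L20 srho DB Di) -?xadd//.
  by rewrite amp_qq_spread// /spread_at x0 x1 x2 xp.
by move=> *; rewrite amp_qq_idle// !mulr0 addr0.
Qed.

Lemma tiling_eigen_bound (theta e : R) psi X : 0 < theta -> theta < 1 ->
  (forall n, (4 <= n)%N -> 3 * f_term n r <= theta ^+ 2) ->
  e != 0 -> H_per lambda kappa L *m psi = e%:C *: psi ->
  no_bad_pattern X -> amp psi X != 0 ->
  kappa / (6 * (1 + 2 * r)) * (1 - theta) ^+ 2 <= e.
Proof.
move=> th0 th1 f_le e0 Hpsi /tilingP[rho [D0 [srho D0B D0i ->]]] psi0.
have r0 := r_gt0.
pose A := dimer_sites rho.
have sA : spaced A.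
  move=> x; rewrite /A !inE !ordSK => /andP[xp _].
  have := srho _ xp; rewrite ord_predK => /andP[/negPf x0 /negPf x1].
  by rewrite x0 x1.
have L3 : (3 < L)%N by apply: leq_trans L20.
have L6 : (6 < L)%N by apply: leq_trans L20.
have K0 : 0 <= 6 * (1 + 2 * r) / (1 - theta) ^+ 2.
  by rewrite divr_ge0 ?sqr_ge0// mulr_ge0// addr_ge0// mulr_ge0// ltW.
pose f D := lambda ^- #|D| * amp psi (tiling rho D).
have fE D : D \subset A -> indep (@adj3 L) D ->
  e%:C * f D = kappa%:C * (\sum_(x in D) (f D - f (D :\ x)) + r%:C *
    \sum_(x in A | (x \notin D) && indep (@adj3 L) (x |: D)) (f D - f (x |: D))).
  move=> DA Di; have := amp_H_tiling psi srho DA Di.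
  rewrite Hpsi ampZ /f => h; rewrite mulrCA h mulrCA; congr (_ * _).
  rewrite mulrDr !big_distrr /=; congr (_ + _); apply: eq_bigr => x xD.
    rewrite (cardsD1 x D) xD add1n exprS invfM.
    by move: (lambda ^- #|D :\ x|) => l; field.
  case/and3P: xD => _ xD _; rewrite -conj_mul_lambda cardsU1 xD add1n.
  rewrite exprS invfM; move: (lambda ^- #|D|) => l.
  by field.
(* The Poincare inequality is for real functions. As e, kappa and r are real, the real and imaginary
   parts of [f] satisfy the same equation, and one of them is nonzero at [D0]. *)
have part (g : R[i] -> R) : (forall a b, g (a + b) = g a + g b) ->
    (forall a b, g (a%:C * b) = a * g b) -> g (f D0) != 0 ->
    kappa / (6 * (1 + 2 * r)) * (1 - theta) ^+ 2 <= e.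
  move=> gD gZ gf.
  have gB a b : g (a - b) = g a - g b.
    have := gZ (-1) b; rewrite rmorphN1 !mulN1r => gN; by rewrite gD gN.
  have g0 : g 0 = 0 by have := gB 0 0; rewrite !subrr.
  have := @eigen_bound R _ (@adj3 L) (@adj3C L) (adj3xx L3) r r0 A
    (6 * (1 + 2 * r) / (1 - theta) ^+ 2) e kappa (g \o f) kappa_gt0 e0.
  have gsum (I : finType) (P : pred I) (F : I -> R[i]) :
      g (\sum_(i | P i) F i) = \sum_(i | P i) g (F i).
    by apply: (big_morph g).
  move=> /(_ (fun F => ring_poincare r0 th0 th1 f_le F L6 sA) K0) H.
  have {}H : kappa <= 6 * (1 + 2 * r) / (1 - theta) ^+ 2 * e.
    apply: H; last by exists D0; split.
    move=> D DA Di; rewrite /= -gZ fE// gZ gD gZ !gsum; congr (_ * (_ + _ * _)).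
      by apply: eq_bigr => x _; rewrite gB.
    by apply: eq_bigr => x _; rewrite gB.
  rewrite mulrAC ler_pdivrMr; last by rewrite mulr_gt0// addr_gt0// mulr_gt0.
  move: H; rewrite mulrAC ler_pdivlMr ?exprn_gt0 ?subr_gt0//.
  by rewrite [e * _]mulrC.
have fD0 : f D0 != 0 by rewrite mulf_neq0// invr_eq0 expf_neq0.
have [Re0|Re0] := eqVneq (complex.Re (f D0)) 0; last first.
  by apply: part Re0 => [[a b] [c d]|a [c d]]//=; rewrite mul0r subr0.
have Im0 : complex.Im (f D0) != 0.
  by apply: contra fD0 => /eqP Im0; rewrite eq_complex Re0 Im0 !eqxx.
by apply: part Im0 => [[a b] [c d]|a [c d]]//=; rewrite mul0r addr0.
Qed.

End Spectrum.

(** * Configurations that are not tilings *)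

Section BadConfigurations.
Variables (R : realType) (L : nat).
Hypothesis L20 : (20 < L)%N.
Implicit Types (x y : 'I_L) (X Y : {set 'I_L}).
Local Notation S1 := (@ordS L).
Local Notation P1 := (@ord_pred L).

Definition next2 x X := (x \in X) && (S1 (S1 x) \in X).

Definition no_next2 X := [forall y, ~~ next2 y X].

(* The patterns 011001, 100110 and 01100011 of a configuration without pairs at
   distance two. Spreading the dimer at x creates such a pair in the first two;
   in the third one this takes a second hop, which contracts the particles at
   x + 2 and x + 5. *)
Definition bad_right x X := [&& no_next2 X, dimer_at x X & iter 4 S1 x \in X].

Definition bad_left x X :=
  [&& no_next2 X, dimer_at x X, iter 4 S1 x \notin X & iter 3 P1 x \in X].

Definition bad_pair x X :=
  [&& no_next2 X, dimer_at x X, iter 4 S1 x \notin X, iter 3 P1 x \notin X,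
      iter 5 S1 x \in X & iter 6 S1 x \in X].

Definition double_toggle x X := toggle (iter 3 S1 x) (toggle x X).

Lemma no_next2P X y : no_next2 X -> y \in X -> S1 (S1 y) \in X = false.
Proof. by move=> /forallP/(_ y); rewrite /next2; case: (y \in X) => //= /negPf. Qed.

(** The negated conditions in [bad_left] and [bad_pair] rank the cases, so that at a given x at most
    one of the three holds. *)
Lemma bad_cases X : ~ no_bad_pattern X -> no_next2 X ->
  exists x, [|| bad_right x X, bad_left x X | bad_pair x X].
Proof.
move=> hX nX; have nn y := @no_next2P X y nX.
have dimerE y : y \in X -> S1 y \in X -> dimer_at y X.
  move=> y0 y1; rewrite /dimer_at y0 y1 (nn _ y0) andbT /=; apply/negP => yp.
  by have := nn _ yp; rewrite ord_predK y1.
apply: contrapT => h; apply: hX => y.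
have {}h x : [|| bad_right x X, bad_left x X | bad_pair x X] = false.
  by apply/negP => hx; apply: h; exists x.
apply/and4P; split; apply/negP.
- by case/andP => y0 /=; rewrite (nn _ y0).
- case/and3P => y0 y1 y4; have := h y.
  by rewrite /bad_right nX (dimerE _ y0 y1) y4.
- case/and3P => y0 y3 y4; have := h (iter 3 S1 y).
  rewrite /bad_right /bad_left nX (dimerE _ y3 y4) /= !ordSK y0.
  by case: (_ \in X).
case/and4P => y0 y1 y5 y6; have := h y.
rewrite /bad_right /bad_left /bad_pair nX (dimerE _ y0 y1) y5 y6.
by case: (_ \in X); case: (_ \in X).
Qed.

Lemma toggle_iter j k b X : (j < 20)%N -> (k < 17)%N ->
  (iter j S1 b \in toggle (iter k.+1 S1 b) X)
  = (iter j S1 b \in X) (+) (j \in [:: k; k.+1; k.+2; k.+3]).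
Proof.
move=> j20 k17; have l m : (m < 20)%N -> (m < L)%N by move=> h; apply: ltn_trans L20.
rewrite in_toggle !inE [P1 _]/= ordSK -!iterS.
by rewrite !iter_eqE//; apply: l => //; lia.
Qed.

Lemma bad_right_toggle x X : bad_right x (toggle x X) -> next2 (iter 2 S1 x) X.
Proof.
have [b ->] := from_left 4 x; rewrite /bad_right /dimer_at /next2.
case/and3P => _ /and4P[_ _ _ h1] h2.
have := @toggle_iter 6 3 b X isT isT; have := @toggle_iter 8 3 b X isT isT.
rewrite -!iterD in h2 *; rewrite -!iterS in h1 *; rewrite h2 (negPf h1).
by case: (_ \in X); case: (_ \in X).
Qed.

Lemma bad_left_toggle x X : bad_left x (toggle x X) -> next2 (iter 3 P1 x) X.
Proof.
have [b ->] := from_left 4 x; rewrite /bad_left /dimer_at /next2 /= !ordSK.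
case/and4P => _ /and4P[_ _ h1 _] _ h2; move: h1 h2.
rewrite (@toggle_iter 1 3 b X)// (@toggle_iter 3 3 b X)//=.
by case: (_ \in X); case: (_ \in X).
Qed.

(** After the second hop the particles of x + 2 and x + 5 sit on x + 3 and x + 4, and the one on x +
    4 is at distance two from x + 6. *)
Lemma bad_pair_toggle x X : bad_pair x X ->
  next2 (iter 4 S1 x) (double_toggle x X) /\
  dimer_at (iter 3 S1 x) (double_toggle x X).
Proof.
have [b ->] := from_left 4 x; rewrite /bad_pair /double_toggle /dimer_at /next2 /= !ordSK.
case/and5P => nX /and4P[h4 h5 h3 h6] h8 h1 /andP[h9 h10].
have h7 : S1 (S1 (S1 (S1 (S1 (S1 (S1 b)))))) \in X = false by exact: no_next2P h5.
rewrite -[S1 (S1 (S1 (S1 (S1 (S1 (S1 b))))))]/(iter 7 S1 b) in h7 *.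
rewrite -[S1 (S1 (S1 (S1 b)))]/(iter 4 S1 b) in h4 *.
rewrite -!iterS in h4 h5 h6 h8 h9 h10 *.
rewrite !(@toggle_iter _ 6 b)// !(@toggle_iter _ 3 b)//=.
by rewrite h9 h10 (negPf h8) (negPf h6) h7.
Qed.

(** For an eigenvector psi, m X will be |psi X|^2 and W x X will be |psi X - lambda psi (toggle x
    X)|^2. The fractions 1/6 and 1/3 in [hop1] and [hop2] are shares of the energy of a pair at
    distance two. *)
Variables (m : {set 'I_L} -> R) (W : 'I_L -> {set 'I_L} -> R) (g kappa : R).
Hypotheses (m0 : forall X, 0 <= m X) (W0 : forall x X, 0 <= W x X)
  (kappa0 : 0 <= kappa) (g3 : g <= 1 / 3).
Hypothesis hop1 : forall x X, g * m X <= kappa * W x X + 1 / 6 * m (toggle x X).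
Hypothesis hop2 : forall x X, g * m X <=
  kappa * W x X + kappa * W (iter 3 S1 x) (double_toggle x X)
  + 1 / 3 * m (double_toggle x X).

Local Notation ind b := (nat_of_bool b)%:R.

(* Half of the weight 1/3 of a pair at distance two goes to each of the two
   configurations from which a single hop creates it. *)
Definition right_cost x X := ind (bad_right x X) * (kappa * W x X + 1 / 6 * m (toggle x X)).
Definition left_cost x X := ind (bad_left x X) * (kappa * W x X + 1 / 6 * m (toggle x X)).
Definition pair_cost x X := ind (bad_pair x X) *
  (kappa * W x X + kappa * W (iter 3 S1 x) (double_toggle x X)
  + 1 / 3 * m (double_toggle x X)).

Lemma bad_pointwise X : ~ no_bad_pattern X ->
  g * m X <= \sum_x (1 / 3 * (ind (next2 x X) * m X))
    + \sum_x (right_cost x X + left_cost x X + pair_cost x X).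
Proof.
move=> hX.
have i0 (b : bool) : 0 <= ind b :> R by rewrite ler0n.
have c1 x Y : 0 <= kappa * W x Y + 1 / 6 * m (toggle x Y).
  by rewrite addr_ge0// mulr_ge0// divr_ge0.
have c2 x Y : 0 <= kappa * W x Y + kappa * W (iter 3 S1 x) (double_toggle x Y)
    + 1 / 3 * m (double_toggle x Y).
  by rewrite addr_ge0 ?mulr_ge0 ?divr_ge0// addr_ge0// mulr_ge0.
have rc x : 0 <= right_cost x X by rewrite /right_cost mulr_ge0.
have lc x : 0 <= left_cost x X by rewrite /left_cost mulr_ge0.
have pc x : 0 <= pair_cost x X by rewrite /pair_cost mulr_ge0.
have cc x : 0 <= right_cost x X + left_cost x X + pair_cost x X.
  by rewrite addr_ge0// addr_ge0.
have nc x : 0 <= 1 / 3 * (ind (next2 x X) * m X) by rewrite mulr_ge0 ?divr_ge0// mulr_ge0.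
have [nX|] := boolP (no_next2 X).
  have [x hx] := bad_cases hX nX.
  apply: le_trans (_ : right_cost x X + left_cost x X + pair_cost x X <= _); last first.
    rewrite [X in _ <= _ + X](bigD1 x) //=.
    have s1 : 0 <= \sum_(i | i != x) (right_cost i X + left_cost i X + pair_cost i X).
      by apply: sumr_ge0 => i _.
    have s2 : 0 <= \sum_i (1 / 3 * (ind (next2 i X) * m X)).
      by apply: sumr_ge0 => i _.
    lra.
  case/or3P: hx => hx.
  - have := hop1 x X; have : right_cost x X = kappa * W x X + 1 / 6 * m (toggle x X).
      by rewrite /right_cost hx mulr1n mul1r.
    have := lc x; have := pc x; lra.
  - have := hop1 x X; have : left_cost x X = kappa * W x X + 1 / 6 * m (toggle x X).
      by rewrite /left_cost hx mulr1n mul1r.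
    have := rc x; have := pc x; lra.
  have := hop2 x X; have : pair_cost x X = kappa * W x X
      + kappa * W (iter 3 S1 x) (double_toggle x X) + 1 / 3 * m (double_toggle x X).
    by rewrite /pair_cost hx mulr1n mul1r.
  have := rc x; have := lc x; lra.
rewrite negb_forall => /existsP[x]; rewrite negbK => hx.
apply: le_trans (_ : 1 / 3 * (ind (next2 x X) * m X) <= _).
  have -> : ind (next2 x X) * m X = m X by rewrite hx mulr1n mul1r.
  by rewrite ler_wpM2r.
rewrite (bigD1 x) //= -addrA lerDl addr_ge0// sumr_ge0//.
Qed.

Lemma toggle_reindex x (F : {set 'I_L} -> R) : \sum_X F X = \sum_X F (toggle x X).
Proof. by rewrite (reindex_inj (inv_inj (toggleK x))). Qed.

Lemma double_toggle_reindex x (F : {set 'I_L} -> R) :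
  \sum_X F (double_toggle x X) = \sum_X F X.
Proof.
by rewrite [RHS](toggle_reindex (iter 3 S1 x)) [RHS](toggle_reindex x).
Qed.

Lemma shift_reindex k (F : 'I_L -> R) : \sum_x F (iter k S1 x) = \sum_x F x.
Proof.
elim: k F => //= k IH F; rewrite (IH (fun x => F (S1 x))).
by rewrite [RHS](reindex_inj (@ordS_inj L)).
Qed.

Lemma shift_back_reindex k (F : 'I_L -> R) : \sum_x F (iter k P1 x) = \sum_x F x.
Proof.
elim: k F => //= k IH F; rewrite (IH (fun x => F (P1 x))).
by rewrite [RHS](reindex_inj (@ord_pred_inj L)).
Qed.

(* Every hop is used by at most one of the estimates. *)
Lemma dimer_count x X :
  ind (bad_right x X) + ind (bad_left x X) + ind (bad_pair x X)
  + ind (bad_pair (iter 3 P1 x) (toggle (iter 3 P1 x) (toggle x X)))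
  <= ind (dimer_at x X) :> R.
Proof.
have [h|_] := boolP (bad_pair (iter 3 P1 x) (toggle (iter 3 P1 x) (toggle x X))).
  have := bad_pair_toggle h; rewrite /double_toggle.
  have -> : iter 3 S1 (iter 3 P1 x) = x by rewrite /= !ord_predK.
  rewrite !toggleK => -[nX ->].
  (* Here the hop at x is the second hop of a [bad_pair] at x - 3. It produces a pair at distance
     two, so X itself falls under none of the three cases. *)
  have nX' : no_next2 X = false.
    by apply/negP => /forallP/(_ (iter 4 S1 (iter 3 P1 x))); rewrite nX.
  by rewrite /bad_right /bad_left /bad_pair nX' /= !add0r.
rewrite addr0 /bad_right /bad_left /bad_pair.
case: (no_next2 X); case: (dimer_at x X); rewrite /= ?addr0 ?ler01//.
case: (iter 4 S1 x \in X); rewrite /= ?addr0//.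
by case: (iter 3 P1 x \in X); rewrite /= ?addr0 ?add0r//; case: (_ && _).
Qed.

(** Each pair at distance two is charged at most once by its own configuration, by [bad_right], by
    [bad_left] and by [bad_pair]; the shares 1/3, 1/6, 1/6 and 1/3 add up to 1. *)
Lemma bad_bound : g * \sum_(X | ~~ `[<no_bad_pattern X>]) m X <=
  \sum_x \sum_X ind (next2 x X) * m X
  + kappa * \sum_x \sum_X ind (dimer_at x X) * W x X.
Proof.
pose N := \sum_x \sum_X ind (next2 x X) * m X.
have i0 (b : bool) : 0 <= ind b :> R by rewrite ler0n.
have ile (a b : bool) X : (a -> b) -> ind a * m X <= ind b * m X.
  by move=> ab; rewrite ler_wpM2r// ler_nat; case: a ab => // ->.
have NR : \sum_x \sum_X ind (bad_right x X) * m (toggle x X) <= N.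
  rewrite /N -[leRHS](shift_reindex 2); apply: ler_sum => x _.
  rewrite [leLHS](toggle_reindex x); apply: ler_sum => X _; rewrite /= toggleK.
  by apply: ile; exact: bad_right_toggle.
have NL : \sum_x \sum_X ind (bad_left x X) * m (toggle x X) <= N.
  rewrite /N -[leRHS](shift_back_reindex 3); apply: ler_sum => x _.
  rewrite [leLHS](toggle_reindex x); apply: ler_sum => X _; rewrite /= toggleK.
  by apply: ile; exact: bad_left_toggle.
have NP : \sum_x \sum_X ind (bad_pair x X) * m (double_toggle x X) <= N.
  rewrite /N -[leRHS](shift_reindex 4); apply: ler_sum => x _.
  rewrite -[leRHS](double_toggle_reindex x); apply: ler_sum => X _.
  by apply: ile => /bad_pair_toggle[].
have WE : \sum_x \sum_X ind (bad_pair x X) * W (iter 3 S1 x) (double_toggle x X)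
   = \sum_x \sum_X
      ind (bad_pair (iter 3 P1 x) (toggle (iter 3 P1 x) (toggle x X))) * W x X.
  rewrite -[RHS](shift_reindex 3); apply: eq_bigr => x _.
  rewrite -[RHS](double_toggle_reindex x); apply: eq_bigr => X _.
  have -> : iter 3 P1 (iter 3 S1 x) = x by rewrite /= !ordSK.
  by rewrite /double_toggle !toggleK.
have WD : \sum_x \sum_X (ind (bad_right x X) * W x X + ind (bad_left x X) * W x X
    + ind (bad_pair x X) * W x X)
   + \sum_x \sum_X ind (bad_pair x X) * W (iter 3 S1 x) (double_toggle x X)
   <= \sum_x \sum_X ind (dimer_at x X) * W x X.
  rewrite WE -big_split; apply: ler_sum => x _; rewrite -big_split.
  by apply: ler_sum => X _ /=; rewrite -!mulrDl ler_wpM2r// dimer_count.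
apply: le_trans (_ : \sum_X (\sum_x (1 / 3 * (ind (next2 x X) * m X))
    + \sum_x (right_cost x X + left_cost x X + pair_cost x X)) <= _).
  rewrite big_distrr /= big_mkcond /=; apply: ler_sum => X _; case: ifPn => hX.
    by apply: bad_pointwise; apply/asboolPn.
  apply: addr_ge0; apply: sumr_ge0 => x _.
    by rewrite mulr_ge0 ?divr_ge0// mulr_ge0.
  by rewrite !addr_ge0 ?mulr_ge0 ?addr_ge0 ?mulr_ge0 ?divr_ge0.
rewrite big_split /= exchange_big /= [X in _ + X]exchange_big /=.
have -> : \sum_x \sum_X 1 / 3 * (ind (next2 x X) * m X) = 1 / 3 * N.
  by rewrite /N big_distrr /=; apply: eq_bigr => x _; rewrite big_distrr.
have -> : \sum_x \sum_X (right_cost x X + left_cost x X + pair_cost x X)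
  = 1 / 6 * (\sum_x \sum_X ind (bad_right x X) * m (toggle x X))
  + 1 / 6 * (\sum_x \sum_X ind (bad_left x X) * m (toggle x X))
  + 1 / 3 * (\sum_x \sum_X ind (bad_pair x X) * m (double_toggle x X))
  + kappa * (\sum_x \sum_X (ind (bad_right x X) * W x X + ind (bad_left x X) * W x X
    + ind (bad_pair x X) * W x X)
   + \sum_x \sum_X ind (bad_pair x X) * W (iter 3 S1 x) (double_toggle x X)).
  rewrite mulrDr !big_distrr -!big_split; apply: eq_bigr => x _ /=.
  rewrite !big_distrr -!big_split; apply: eq_bigr => X _ /=.
  by rewrite /right_cost /left_cost /pair_cost; ring.
have {}WD := ler_wpM2l kappa0 WD.
rewrite -/N; lra.
Qed.

End BadConfigurations.

(** * The spectral gap *)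

Section Energy.
Variables (R : realType) (L : nat).
Hypothesis L20 : (20 < L)%N.
Variables (lambda : R[i]) (kappa : R).
Hypotheses (lambda_neq0 : lambda != 0) (kappa_gt0 : 0 < kappa).
Implicit Types (x : 'I_L) (X : {set 'I_L}) (psi phi : 'cV[R[i]]_#|{: config L}|).
Local Notation S1 := (@ordS L).
Local Notation P1 := (@ord_pred L).
Local Notation r := (Normc.normc lambda ^+ 2).
Local Notation ind b := (nat_of_bool b)%:R.
Local Notation H := (H_per lambda kappa L).

Definition normc2 (z : R[i]) : R := Normc.normc z ^+ 2.

Lemma normc2E z : z^* * z = (normc2 z)%:C.
Proof. by rewrite mulrC -sqr_normc rmorphXn. Qed.

Lemma normc2_ge0 z : 0 <= normc2 z.
Proof. exact: sqr_ge0. Qed.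

Lemma normc2_eq0 z : (normc2 z == 0) = (z == 0).
Proof.
rewrite sqrf_eq0; apply/eqP/eqP => [/Normc.eq0_normc//|->].
exact: Normc.normc0.
Qed.

Lemma dot_adjoint (A : operator R L) phi psi :
  \sum_X (amp phi X)^* * amp (adjoint A *m psi) X
  = \sum_X (amp (A *m phi) X)^* * amp psi X.
Proof.
rewrite -!(sum_amp (fun a b => a^* * b)).
transitivity (\sum_k \sum_l (phi k 0)^* * ((A l k)^* * psi l 0)).
  apply: eq_bigr => k _; rewrite mxE big_distrr /=.
  by apply: eq_bigr => l _; rewrite !mxE.
rewrite exchange_big /=; apply: eq_bigr => l _.
rewrite mxE rmorph_sum big_distrl /=; apply: eq_bigr => k _.
by rewrite rmorphM mulrA [_^* * _]mulrC.
Qed.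

Lemma energyE (e : R) psi : H *m psi = e%:C *: psi ->
  e * \sum_X normc2 (amp psi X) =
  \sum_x \sum_X ind (next2 x X) * normc2 (amp psi X)
  + kappa * \sum_x \sum_X normc2 (amp (q_op lambda x *m psi) X).
Proof.
move=> Hpsi; apply: complexI; rewrite rmorphM rmorphD rmorphM /= !rmorph_sum /=.
transitivity (\sum_X (amp psi X)^* * amp (H *m psi) X).
  rewrite Hpsi big_distrr /=; apply: eq_bigr => X _.
  by rewrite ampZ mulrCA normc2E.
transitivity (\sum_X \sum_x ((ind (next2 x X) * normc2 (amp psi X))%:C
    + kappa%:C * ((amp psi X)^* *
      amp (adjoint (q_op lambda x) *m (q_op lambda x *m psi)) X))).
  apply: eq_bigr => X _; rewrite amp_H big_distrr /=; apply: eq_bigr => x _.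
  rewrite mulrDr mulrCA; congr (_ + _); rewrite /next2; case: (_ && _).
    by rewrite mul1r normc2E.
  by rewrite mulr0 mul0r.
rewrite exchange_big /= big_distrr -big_split /=; apply: eq_bigr => x _.
rewrite big_split /= rmorph_sum -big_distrr /= dot_adjoint rmorph_sum.
by congr (_ + _ * _); apply: eq_bigr => X _; rewrite normc2E.
Qed.

Lemma hop_energy psi x :
  \sum_X ind (dimer_at x X) * normc2 (amp psi X - lambda * amp psi (toggle x X))
  <= \sum_X normc2 (amp (q_op lambda x *m psi) X).
Proof.
have [n1 n2 [n3 n4 n5 n6]] := ordS_neqs L20 x.
(* [flip] reindexes by the configuration left after q_x has removed the dimer, where q_x psi has
   exactly the amplitude on the left; the other configurations contribute nonnegative terms. *)
pose flip X : {set 'I_L} := [set y | (y \in X) (+) ((y == x) || (y == S1 x))].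
have flipK : involutive flip by move=> X; apply/setP => y; rewrite !inE addbK.
rewrite [leLHS](reindex_inj (inv_inj flipK)) /=; apply: ler_sum => X _.
rewrite /dimer_at !inE !eqxx (negPf n1) (negPf n3) (negPf n4) (negPf n5) (negPf n6).
rewrite orbT /= !addbT !addbF.
have [/and4P[x0 x1 xp x2]|_] :=
  boolP [&& x \notin X, S1 x \notin X, P1 x \notin X & S1 (S1 x) \notin X];
  last by rewrite mul0r normc2_ge0.
rewrite mulr1n mul1r amp_q// (negPf x0) (negPf x1) (negPf xp) (negPf x2) /=.
suff [-> ->] : S1 x |: (x |: X) = flip X /\
  S1 (S1 x) |: (P1 x |: X) = toggle x (flip X) by [].
split; apply/setP => z; rewrite ?in_toggle !inE.
  case: (eqVneq z (S1 x)) => [->|_]; first by rewrite (negPf x1) orbT.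
  by case: (eqVneq z x) => [->|_]; rewrite ?(negPf x0) ?addbF.
case: (eqVneq z (S1 (S1 x))) => [->|_].
  by rewrite (negPf x2) (negPf n3) (negPf n6) !orbT.
case: (eqVneq z (P1 x)) => [->|_]; first by rewrite (negPf xp) (negPf n4) (negPf n5).
by rewrite orbF addbK.
Qed.

Lemma gamma_bnd : let g := gamma_per lambda kappa in
  [/\ g <= 1 / 3, g * (6 + 6 * kappa * r) <= kappa & g * (3 * kappa + 6) <= kappa].
Proof.
move=> g; have r0 := r_gt0 lambda_neq0.
have kr : 0 < kappa * r by rewrite mulr_gt0.
have d1 : 0 < 2 + 2 * kappa * r by rewrite -mulrA; lra.
have d2 : 0 < kappa + 2 by have := kappa_gt0; lra.
have m1 : 3 * g <= 1.
  have -> : 3 * g = Num.min 1 (Num.min (kappa / (2 + 2 * kappa * r)) (kappa / (kappa + 2))).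
    by rewrite /g /gamma_per; field.
  by rewrite ge_min lexx.
have m2 : 3 * g <= kappa / (2 + 2 * kappa * r).
  have -> : 3 * g = Num.min 1 (Num.min (kappa / (2 + 2 * kappa * r)) (kappa / (kappa + 2))).
    by rewrite /g /gamma_per; field.
  by rewrite !ge_min lexx orbT.
have m3 : 3 * g <= kappa / (kappa + 2).
  have -> : 3 * g = Num.min 1 (Num.min (kappa / (2 + 2 * kappa * r)) (kappa / (kappa + 2))).
    by rewrite /g /gamma_per; field.
  by rewrite !ge_min lexx !orbT.
rewrite ler_pdivlMr// in m2; rewrite ler_pdivlMr// in m3.
by split; [lra|apply: le_trans m2; rewrite le_eqVlt; apply/orP; left; apply/eqP; ring|
  apply: le_trans m3; rewrite le_eqVlt; apply/orP; left; apply/eqP; ring].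
Qed.

Lemma normc_triangle (z w : R[i]) : Normc.normc z <= Normc.normc (z - w) + Normc.normc w.
Proof. by rewrite -{1}(subrK w z) le_normcD. Qed.

Lemma normc_ge0 (z : R[i]) : 0 <= Normc.normc z.
Proof. by case: z => a b; exact: sqrtr_ge0. Qed.

Lemma hop_bound1 (z w : R[i]) :
  gamma_per lambda kappa * normc2 z <= kappa * normc2 (z - lambda * w) + 1 / 6 * normc2 w.
Proof.
have [_ g1 _] := gamma_bnd; have k0 := kappa_gt0; have r0 := r_gt0 lambda_neq0.
have := normc_triangle z (lambda * w); rewrite Normc.normcM /normc2.
move: (normc_ge0 z) (normc_ge0 (z - lambda * w)) (normc_ge0 w) (normc_ge0 lambda) g1 r0.
move: (Normc.normc z) (Normc.normc (z - lambda * w)) (Normc.normc w) (Normc.normc lambda)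
  (gamma_per lambda kappa) => a u v l g a0 u0 v0 l0 g1 r0 tri.
have kl : 0 < 6 + 6 * kappa * l ^+ 2 by rewrite addr_gt0// (mulr_gt0 _ r0)// mulr_gt0.
rewrite -(ler_pM2l kl); apply: (@le_trans _ _ (kappa * (u + l * v) ^+ 2)).
  rewrite mulrA [_ * g]mulrC; apply: le_trans (_ : kappa * a ^+ 2 <= _).
    by rewrite ler_wpM2r ?sqr_ge0.
  by rewrite ler_wpM2l ?(ltW k0)// lerXn2r ?nnegrE// addr_ge0// mulr_ge0.
(* Cauchy-Schwarz: kappa (u + l v)^2 <= (1 + 6 kappa l^2)(kappa u^2 + v^2 / 6), with 1 enlarged to 6
   to match the bound on [gamma_per]. *)
rewrite -subr_ge0.
have -> : (6 + 6 * kappa * l ^+ 2) * (kappa * u ^+ 2 + 1 / 6 * v ^+ 2)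
    - kappa * (u + l * v) ^+ 2
  = 5 * kappa * u ^+ 2 + 5 * (kappa * l * u) ^+ 2 + (kappa * l * u - v) ^+ 2 by field.
have c0 : 0 <= 5 * kappa by rewrite mulr_ge0// ltW.
by apply: addr_ge0; [apply: addr_ge0|]; rewrite ?sqr_ge0// mulr_ge0 ?sqr_ge0.
Qed.

(** One hop spreads and the other contracts, so both z and v are compared with lambda w and the
    factors lambda cancel. This is why the third bound in [gamma_per] is free of lambda. *)
Lemma hop_bound2 (z w v : R[i]) :
  gamma_per lambda kappa * normc2 z <=
  kappa * normc2 (z - lambda * w) + kappa * normc2 (v - lambda * w) + 1 / 3 * normc2 v.
Proof.
have [_ _ g1] := gamma_bnd; have k0 := kappa_gt0.
have tri : Normc.normc z <= Normc.normc (z - lambda * w) + Normc.normc (v - lambda * w)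
    + Normc.normc v.
  rewrite -addrA; apply: le_trans (normc_triangle z (lambda * w)) _.
  by rewrite lerD2l -[v - _]opprB normcN normc_triangle.
move: tri; rewrite /normc2.
move: (normc_ge0 z) (normc_ge0 (z - lambda * w)) (normc_ge0 (v - lambda * w))
  (normc_ge0 v) g1.
move: (Normc.normc z) (Normc.normc (z - lambda * w)) (Normc.normc (v - lambda * w))
  (Normc.normc v) (gamma_per lambda kappa) => a u1 u2 t g a0 u10 u20 t0 g1 tri.
have kl : 0 < 3 * kappa + 6 by rewrite addr_gt0// mulr_gt0.
rewrite -(ler_pM2l kl); apply: (@le_trans _ _ (kappa * (u1 + u2 + t) ^+ 2)).
  rewrite mulrA [_ * g]mulrC; apply: le_trans (_ : kappa * a ^+ 2 <= _).
    by rewrite ler_wpM2r ?sqr_ge0.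
  by rewrite ler_wpM2l ?(ltW k0)// lerXn2r ?nnegrE// !addr_ge0.
rewrite -subr_ge0.
have -> : (3 * kappa + 6) * (kappa * u1 ^+ 2 + kappa * u2 ^+ 2 + 1 / 3 * t ^+ 2)
    - kappa * (u1 + u2 + t) ^+ 2
  = kappa * (u1 - u2) ^+ 2 + (kappa * u1 - t) ^+ 2 + (kappa * u2 - t) ^+ 2
    + (2 * kappa ^+ 2 + 4 * kappa) * (u1 ^+ 2 + u2 ^+ 2) by field.
have c0 : 0 <= 2 * kappa ^+ 2 + 4 * kappa by rewrite addr_ge0 ?mulr_ge0 ?sqr_ge0// ltW.
apply: addr_ge0; last by rewrite mulr_ge0// addr_ge0 ?sqr_ge0.
apply: addr_ge0; [apply: addr_ge0|]; rewrite ?sqr_ge0//.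
by rewrite mulr_ge0 ?sqr_ge0 ?(ltW k0).
Qed.

Lemma bad_eigen_bound (e : R) psi : H *m psi = e%:C *: psi -> psi != 0 ->
  (forall X, no_bad_pattern X -> amp psi X = 0) -> gamma_per lambda kappa <= e.
Proof.
move=> Hpsi psi0 hf; have [g3 _ _] := gamma_bnd.
pose m X := normc2 (amp psi X).
pose W x X := normc2 (amp psi X - lambda * amp psi (toggle x X)).
have m0 X : 0 <= m X by exact: normc2_ge0.
have mp : 0 < \sum_X m X.
  rewrite lt0r sumr_ge0// andbT; apply: contra psi0; rewrite psumr_eq0// => /allP h.
  apply/eqP/amp_eq0 => X; apply/eqP; rewrite -normc2_eq0.
  by apply: (implyP (h X _)) => //; rewrite mem_index_enum.
have := @bad_bound R L L20 m W (gamma_per lambda kappa) kappa m0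
  (fun _ _ => normc2_ge0 _) (ltW kappa_gt0) g3
  (fun x X => hop_bound1 _ _).
have h2 x X : gamma_per lambda kappa * m X <= kappa * W x X
    + kappa * W (iter 3 S1 x) (double_toggle x X) + 1 / 3 * m (double_toggle x X).
  by rewrite /W /double_toggle toggleK; exact: hop_bound2.
move=> /(_ h2) h; rewrite -(ler_pM2r mp); move: h.
have -> : \sum_(X | ~~ `[<no_bad_pattern X>]) m X = \sum_X m X.
  rewrite [RHS](bigID (fun X => `[<no_bad_pattern X>])) /= [X in X + _]big1 ?add0r//.
  by move=> X /asboolP hX; rewrite /m hf//; apply/eqP; rewrite normc2_eq0.
move=> h; rewrite (energyE Hpsi); apply: le_trans h _; rewrite lerD2l.
by rewrite ler_wpM2l ?(ltW kappa_gt0)//; apply: ler_sum => x _; exact: hop_energy.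
Qed.

Lemma spectrum_bound (theta e : R) : 0 < theta -> theta < 1 ->
  (forall n, (4 <= n)%N -> 3 * f_term n r <= theta ^+ 2) ->
  spectrum H e -> e != 0 ->
  Num.min (kappa / (6 * (1 + 2 * r)) * (1 - theta) ^+ 2) (gamma_per lambda kappa) <= e.
Proof.
move=> th0 th1 f_le /right_eigenvalueP[psi Hpsi psi0] e0.
have [[X [hX pX]]|none] := pselect (exists X, no_bad_pattern X /\ amp psi X != 0).
  rewrite ge_min; apply/orP; left.
  exact: (tiling_eigen_bound L20 lambda_neq0 kappa_gt0 th0 th1 f_le e0 Hpsi hX pX).
rewrite ge_min; apply/orP; right; apply: (bad_eigen_bound Hpsi psi0) => X hX.
by apply: contrapT => /eqP pX; apply: none; exists X.
Qed.

Definition basis_state X : 'cV[R[i]]_#|{: config L}| :=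
  delta_mx (enum_rank (occupation X)) 0.

Lemma amp_basis X Y : amp (basis_state X) Y = (Y == X)%:R.
Proof.
rewrite /amp mxE eqxx andbT (inj_eq enum_rank_inj).
by rewrite (inj_eq (bij_inj (occupation_bij L))).
Qed.

Lemma basis_state_neq0 X : basis_state X != 0.
Proof.
apply/eqP => h; have := amp_basis X X; rewrite h eqxx /amp mxE => /eqP.
by rewrite eq_sym oner_eq0.
Qed.

Lemma spectrum0 : spectrum H 0.
Proof.
apply/right_eigenvalueP; exists (basis_state set0); last exact: basis_state_neq0.
rewrite scale0r; apply: amp_eq0 => X; rewrite amp_H big1// => x _.
have -> : q_op lambda x *m basis_state set0 = 0.
  apply: amp_eq0 => Y; rewrite amp_q// !amp_basis.
  have ne y Z : (y |: Z == set0) = false.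
    by apply/negbTE/set0Pn; exists y; rewrite setU11.
  by rewrite !ne !if_same mulr0 subrr.
rewrite mulmx0 amp_basis; case: eqP => [->|_]; last first.
  by rewrite if_same add0r /amp mxE mulr0.
by rewrite inE add0r /amp mxE mulr0.
Qed.

(** Some positive eigenvalue must be exhibited, since the infimum defining the first excited energy
    would take a default value on the empty set. On the full ring the cross terms of each q_x die by
    exclusion, which makes the state an eigenvector. *)
Lemma spectrum_full : spectrum H (\sum_(x < L) (1 + kappa * (1 + r))).
Proof.
apply/right_eigenvalueP; exists (basis_state [set: 'I_L]); last exact: basis_state_neq0.
apply/eqP; rewrite -subr_eq0; apply/eqP/amp_eq0 => X.
rewrite ampD ampN ampZ amp_H amp_basis.
apply/eqP; rewrite subr_eq0; apply/eqP; rewrite rmorph_sum big_distrl /=.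
apply: eq_bigr => x _; have [n1 n2 [n3 n4 n5 n6]] := ordS_neqs L20 x.
rewrite amp_q_adj// !amp_q// !inE !eqxx.
rewrite !(negPf n1, negPf n2, negPf n3, negPf n4, negPf n5, negPf n6) /=.
rewrite !amp_basis.
have addK y z : y \in X -> z \in X -> y |: (z |: X :\ y :\ z) = X.
  move=> yX zX; apply/setP => w; rewrite !inE.
  case: (eqVneq w y) => [->|_] /=; first by rewrite yX.
  by case: (eqVneq w z) => [->|_].
have c2 : (S1 (S1 x) |: (P1 x |: X :\ S1 x :\ x) == setT) = false.
  apply/negbTE/eqP => /setP/(_ x); rewrite !inE eqxx.
  by rewrite [x == S1 (S1 x)]eq_sym (negPf n3) [x == P1 x]eq_sym (negPf n4).
have c3 : (S1 x |: (x |: X :\ S1 (S1 x) :\ P1 x) == setT) = false.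
  by apply/negbTE/eqP => /setP/(_ (P1 x)); rewrite !inE eqxx (negPf n4) (negPf n5).
rewrite c2 c3 !if_same mulr0 subr0.
have [XT|XT] := eqVneq X setT.
  rewrite !addK ?XT ?inE// !eqxx rmorphD rmorphM rmorphD rmorph1.
  by rewrite /= sub0r !mulr1 mulrN opprK conj_mul_lambda.
have [/andP[x0 x1]|_] := boolP ((x \in X) && (S1 x \in X)).
  rewrite addK// (negPf XT) if_same add0r mulr0.
  have [/andP[xp x2]|_] := boolP ((P1 x \in X) && (S1 (S1 x) \in X)).
    by rewrite addK// (negPf XT) !mulr0 subrr !mulr0 subrr mulr0.
  by rewrite !mulr0 subrr mulr0.
rewrite if_same add0r mulr0 sub0r.
have [/andP[xp x2]|_] := boolP ((P1 x \in X) && (S1 (S1 x) \in X)).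
  by rewrite addK// (negPf XT) !mulr0 subrr !mulr0 oppr0 mulr0.
by rewrite !mulr0 oppr0 mulr0.
Qed.

Lemma gap_bound (theta : R) : 0 < theta -> theta < 1 ->
  (forall n, (4 <= n)%N -> 3 * f_term n r <= theta ^+ 2) ->
  Num.min (kappa / (6 * (1 + 2 * r)) * (1 - theta) ^+ 2) (gamma_per lambda kappa)
  <= gap H.
Proof.
move=> th0 th1 f_le; set c := Num.min _ _.
have r0 := r_gt0 lambda_neq0.
have c0 : 0 <= c.
  have kr : 0 < kappa * r by rewrite mulr_gt0.
  have k0 := ltW kappa_gt0; have r0' := ltW r0; have kr' := ltW kr.
  rewrite le_min; apply/andP; split.
    by apply: mulr_ge0 (sqr_ge0 _); rewrite divr_ge0// mulr_ge0// addr_ge0// mulr_ge0.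
  rewrite /gamma_per; apply: mulr_ge0; first by rewrite divr_ge0.
  rewrite !le_min ler01 /=; apply/andP; split; last by rewrite divr_ge0// addr_ge0.
  by rewrite divr_ge0// -mulrA addr_ge0// mulr_ge0.
have sp e : spectrum H e -> e != 0 -> c <= e by exact: spectrum_bound.
have sp0 e : spectrum H e -> 0 <= e.
  by move=> He; have [->//|e0] := eqVneq e 0; exact: le_trans (sp e He e0).
have g0 : ground_energy H = 0.
  apply/eqP; rewrite eq_le; apply/andP; split.
    by apply: ge_inf; [exists 0 => e; exact: sp0|exact: spectrum0].
  by apply: lb_le_inf; [exists 0; exact: spectrum0|move=> e; exact: sp0].
rewrite /gap /first_excited_energy g0 subr0; apply: lb_le_inf.
  exists (\sum_(x < L) (1 + kappa * (1 + r))); split; first exact: spectrum_full.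
  apply/eqP; rewrite gt_eqF// sumr_const card_ord pmulrn_lgt0 ?(ltn_trans _ L20)//.
  by rewrite addr_gt0// mulr_gt0// addr_gt0.
by move=> e [He /eqP e0]; exact: sp.
Qed.

End Energy.

Lemma limn_einf_ge (R : realType) (u : nat -> \bar R) (c : \bar R) N :
  (forall n, (N <= n)%N -> (c <= u n)%E) -> (c <= limn_einf u)%E.
Proof.
move=> h; rewrite limn_einf_lim (cvg_lim _ (@cvg_einfs_sup _ u))//.
apply: (@ereal_sup_ge _ _ _); exists (einfs u N); first by exists N.
by apply: le_ereal_inf_tmp => _ [n /= Nn <-]; exact: h.
Qed.

Theorem theorem1p1 (R : realType) (lambda : R[i]) (kappa : R)
    (lambda_neq0 : lambda != 0) (kappa_gt0 : 0 < kappa) :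
  {in `[0, +oo[ &, {homo @f_sup R : r s / r <= s}} /\
  (f_sup (Normc.normc lambda ^+ 2) < 1 / 3 ->
   ((Num.min
       (kappa / (6 * (1 + 2 * Normc.normc lambda ^+ 2))
        * (1 - Num.sqrt (3 * f_sup (Normc.normc lambda ^+ 2))) ^+ 2)
       (gamma_per lambda kappa))%:E
    <= limn_einf (fun L : nat => (gap (H_per lambda kappa L))%:E))%E).
Proof.
split=> [|f_lt]; first exact: f_sup_mono.
have r0 := r_gt0 lambda_neq0; have f0 := f_sup_gt0 r0.
have theta2 : Num.sqrt (3 * f_sup (Normc.normc lambda ^+ 2)) ^+ 2
    = 3 * f_sup (Normc.normc lambda ^+ 2).
  by rewrite sqr_sqrtr// mulr_ge0// ltW.
(* The gap bound holds from L = 21 on, where the local windows fit on the ring; finitely many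
   smaller rings do not affect the limit inferior. *)
apply: (@limn_einf_ge _ _ _ 21) => L L20; rewrite lee_fin.
apply: gap_bound => //.
- by rewrite sqrtr_gt0 mulr_gt0.
- rewrite -[ltRHS]sqrtr1 ltr_sqrt//; lra.
- by move=> n n4; rewrite theta2 ler_wpM2l// f_sup_ub// ltW.
Qed.
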